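(* (i) For $r\in\{3,4\}$, almost all $r$-uniform hypergraphs are strongly $2$-weighted but not strongly $1$-weighted. (ii) Let $H_n$ be chosen uniformly at random among all $5$-uniform hypergraphs on vertex set $[n]$. Then $\Pr(H_n \text{ is strongly 1-weighted}) = e^{-\sqrt{6/\pi}}+o(1)$ and $\Pr(H_n \text{ is strongly 2-weighted but not strongly 1-weighted}) = 1-e^{-\sqrt{6/\pi}}+o(1)$. (iii) For every $r\ge 6$, almost all $r$-uniform hypergraphs are strongly $1$-weighted.
   Context: An $r$-uniform hypergraph $H=(V,E)$ has every edge of size $r$. Given $\omega:E\to\{1,\dots,w\}$, the induced vertex-coloring is $c(v)=\sum_{e\ni v}\omega(e)$. The coloring is strong if every edge is rainbow (no two vertices of an edge get the same color). $H$ is strongly $w$-weighted if some $\omega:E\to\{1,\dots,w\}$ induces a strong coloring. ''Almost all $r$-uniform hypergraphs on $n$ vertices have property $\mathcal P$'' means that the number of $r$-uniform hypergraphs on vertex set $[n]$ without $\mathcal P$ is $o\big(2^{\binom{n}{r}}\big)$ as $n\to\infty$ (equivalently, the random hypergraph in which each $r$-subset of $[n]$ is an edge independently with probability $1/2$ has $\mathcal P$ with probability $1-o(1)$). *)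

(* Defs.v *)
From mathcomp Require Import all_boot.
From Stdlib Require Import Reals.

Set Implicit Arguments.
Unset Strict Implicit.
Unset Printing Implicit Defensive.

Definition uniform (n r : nat) (H : {set {set 'I_n}}) : bool :=
  [forall e in H, #|e| == r].

(* Weighting with values in {1,...,w}: wt e : 'I_w encodes the weight (wt e).+1.
   Induced color of v: sum of weights of edges containing v. *)
Definition induced_color (n w : nat) (H : {set {set 'I_n}})
    (wt : {ffun {set 'I_n} -> 'I_w}) (v : 'I_n) : nat :=
  \sum_(e in H | v \in e) (nat_of_ord (wt e)).+1.

Definition strong_coloring (n w : nat) (H : {set {set 'I_n}})
    (wt : {ffun {set 'I_n} -> 'I_w}) : bool :=
  [forall e in H, forall u in e, forall v in e,
     (u != v) ==> (induced_color H wt u != induced_color H wt v)].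

Definition strongly_weighted (w n : nat) (H : {set {set 'I_n}}) : bool :=
  [exists wt : {ffun {set 'I_n} -> 'I_w}, strong_coloring H wt].

Definition prob (r : nat) (P : forall n : nat, {set {set 'I_n}} -> bool)
    (n : nat) : R :=
  Rdiv (INR #|[set H : {set {set 'I_n}} | uniform r H && P n H]|)
       (INR (2 ^ 'C(n, r))).

Definition almost_all (r : nat) (P : forall n : nat, {set {set 'I_n}} -> bool) : Prop :=
  Un_cv (prob r (fun n H => ~~ P n H)) 0%R.

Definition sw1 (n : nat) (H : {set {set 'I_n}}) : bool := strongly_weighted 1 H.
Definition sw2_not_sw1 (n : nat) (H : {set {set 'I_n}}) : bool :=
  strongly_weighted 2 H && ~~ strongly_weighted 1 H.

(* Main.v *)
Require Import Defs.
From Stdlib Require Import Reals Lra.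
From Coquelicot Require Import Coquelicot.
From mathcomp Require Import all_boot all_order all_algebra all_fingroup.
From mathcomp Require Import Rstruct.
From mathcomp Require Import zify ring lra.

Set Implicit Arguments.
Unset Strict Implicit.
Unset Printing Implicit Defensive.

Import Order.TTheory GRing.Theory Num.Theory.
Local Open Scope ring_scope.

(** Exchanging two vertices u, v inside a set T of (r-1)-sets preserves the uniform measure and all
    degrees except those of u and v.  Averaging over T makes deg u - deg v an explicit centred
    binomial, whence Pr(deg u = deg v) ~ 1/sqrt(pi N) with N = C(n-2, r-1), approximately independently
    of the other degrees.  Stein's identity E[lam f(Z+1) - Z f(Z)] ~ 0 for the number Z of coincident
    pairs then gives Pr(Z = 0) ~ exp(-lam) with lam ~ C(n,2)/sqrt(pi N): lam tends to 0 for r >= 6, to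
    sqrt(6/pi) for r = 5, and is unbounded for r = 3, 4.  Any two vertices share an edge with high
    probability, so being strongly 1-weighted is essentially the event Z = 0.  Two weights suffice
    because the weights of S+u and S+v can be exchanged for many S without affecting the colours of
    other vertices, which allows a greedy choice over disjoint pairs u, v. *)

(** * Expectation and probability on finite uniform spaces *)

Section FiniteProbability.

Variables (R : realFieldType) (X : finType).
Implicit Types (f g : X -> R) (P Q : pred X).

(** Throughout r = k + 1, and the random object is a uniform family of arbitrary vertex sets, whose
    members of size r form the random hypergraph. The main obstacle is parity: swaps preserve the
    number m of mixed links, and deg u = deg v is impossible for odd m, while for even m it has
    conditional probability C(m, m/2) / 2^m. Toggling one edge, made of u and a fixed k-set S0,
    changes the parity of m; averaging both cases gives half a Wallis ratio of index near N/4, that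
    is beta/2 with beta = 2 / sqrt(pi N). This toggle must not disturb the other degrees in play, so
    coincidences are counted inside a set A disjoint from S0. The Stein error relative to lam
    contains a term of order |A| beta. For r = 3, beta is of order 1/n, so A cannot be nearly
    everything; it is shrunk to about sqrt(L n) vertices, which keeps lam above a multiple of L.
    There and for r = 4, testing with the indicator of 1 gives Pr(Z = 0) <= 1/lam + error. For r = 5
    the test function solves Stein's equation for the indicator of 0. *)

Definition Ex f : R := (\sum_x f x) / #|X|%:R.
Definition Pr P : R := Ex (fun x => (P x)%:R).

Lemma eq_Ex f g : f =1 g -> Ex f = Ex g.
Proof. by move=> fg; congr (_ / _); apply: eq_bigr => x _. Qed.

Lemma ExD f g : Ex (fun x => f x + g x) = Ex f + Ex g.
Proof. by rewrite /Ex big_split mulrDl. Qed.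

Lemma ExZ a f : Ex (fun x => a * f x) = a * Ex f.
Proof. by rewrite /Ex -mulr_sumr mulrA. Qed.

Lemma ExB f g : Ex (fun x => f x - g x) = Ex f - Ex g.
Proof. by rewrite /Ex sumrB mulrBl. Qed.

Lemma Ex_sum (I : finType) (D : pred I) (F : I -> X -> R) :
  Ex (fun x => \sum_(i | D i) F i x) = \sum_(i | D i) Ex (F i).
Proof. by rewrite /Ex exchange_big mulr_suml. Qed.

Lemma ler_Ex f g : (forall x, f x <= g x) -> Ex f <= Ex g.
Proof. by move=> fg; rewrite ler_wpM2r ?invr_ge0 ?ler0n // ler_sum. Qed.

Lemma Ex_ge0 f : (forall x, 0 <= f x) -> 0 <= Ex f.
Proof. by move=> f0; rewrite divr_ge0 ?ler0n // sumr_ge0. Qed.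

Lemma ler_norm_Ex f : `|Ex f| <= Ex (fun x => `|f x|).
Proof.
rewrite normrM [`|_^-1|]ger0_norm ?invr_ge0 ?ler0n //.
by rewrite ler_wpM2r ?invr_ge0 ?ler0n // ler_norm_sum.
Qed.

Lemma Ex_inj (h : X -> X) f : injective h -> Ex (fun x => f (h x)) = Ex f.
Proof. by move=> h_inj; rewrite /Ex [in RHS](reindex_inj h_inj). Qed.

Lemma eq_Pr P Q : P =1 Q -> Pr P = Pr Q.
Proof. by move=> PQ; apply: eq_Ex => x; rewrite PQ. Qed.

Lemma Pr_ge0 P : 0 <= Pr P.
Proof. by apply: Ex_ge0 => x; rewrite ler0n. Qed.

Lemma ler_Pr P Q : (forall x, P x -> Q x) -> Pr P <= Pr Q.
Proof. move=> PQ; apply: ler_Ex => x; rewrite ler_nat.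
by have := PQ x; case: (P x) => // /(_ isT) ->. Qed.

Lemma ler_PrU P Q1 Q2 :
  (forall x, P x -> Q1 x || Q2 x) -> Pr P <= Pr Q1 + Pr Q2.
Proof.
move=> PQ; rewrite -ExD; apply: ler_Ex => x; rewrite -natrD ler_nat.
by have := PQ x; case: (P x) (Q1 x) (Q2 x) => [] [] [] // /(_ isT).
Qed.

Lemma ler_Pr_sum (I : finType) (D : pred I) P (Q : I -> pred X) :
  (forall x, P x -> exists2 i, D i & Q i x) -> Pr P <= \sum_(i | D i) Pr (Q i).
Proof.
move=> PQ; rewrite -Ex_sum; apply: ler_Ex => x.
case Px: (P x); last by rewrite sumr_ge0 // => i _; rewrite ler0n.
have [i Di Qi] := PQ x Px.
rewrite (bigD1 i) //= Qi lerDl sumr_ge0 // => j _; rewrite ler0n //.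
Qed.

Lemma ler_Pr_sum_cst (I : finType) (D : pred I) P (Q : I -> pred X) b :
    (forall x, P x -> exists2 i, D i & Q i x) ->
    (forall i, D i -> Pr (Q i) <= b) ->
  Pr P <= #|D|%:R * b.
Proof.
move=> /ler_Pr_sum /le_trans + Qb; apply; rewrite mulr_natl -sumr_const.
exact: ler_sum.
Qed.

Lemma chebyshev f a : 0 < a -> Pr (fun x => a <= `|f x|) <= Ex (fun x => f x ^+ 2) / a ^+ 2.
Proof.
move=> a0; rewrite ler_pdivlMr ?exprn_gt0 // mulrC -ExZ; apply: ler_Ex => x.
case: (leP a `|f x|) => [afx | _]; rewrite ?mulr0 ?sqr_ge0 ?mulr1 //.
by rewrite -[leRHS]real_normK ?num_real // lerXn2r ?nnegrE ?(ltW a0).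
Qed.

Hypothesis X_gt0 : (0 < #|X|)%N.

Lemma Ex_cst (a : R) : Ex (fun=> a) = a.
Proof.
by rewrite /Ex sumr_const -[a *+ _]mulr_natr mulfK // pnatr_eq0 -lt0n.
Qed.

Lemma Pr_le1 P : Pr P <= 1.
Proof. by rewrite -[leRHS]Ex_cst; apply: ler_Ex => x; rewrite lern1 leq_b1. Qed.

Lemma PrC P : Pr (predC P) = 1 - Pr P.
Proof.
rewrite -(Ex_cst 1) -ExB; apply: eq_Ex => x /=.
by case: (P x); rewrite ?subrr ?subr0.
Qed.

End FiniteProbability.
Arguments Pr R {X} P.

(** * Traces of a uniform random set *)

Section RandomSet.

Variables (R : realFieldType) (T : finType).
Implicit Types (M H D : {set T}).

Lemma card_set_gt0 : (0 < #|{set T}|)%N.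
Proof. by apply/card_gt0P; exists set0. Qed.

Lemma card_set_exp : #|{set T}| = (2 ^ #|T|)%N.
Proof. by rewrite -[LHS]cardsT -powersetT card_powerset cardsT. Qed.

(** Each subset of [M] is the trace of exactly [2 ^ #|~: M|] sets, one per choice outside [M], so
    the trace of a uniform set is uniform on the powerset. *)
Lemma Ex_setI M (f : {set T} -> R) :
  Ex (fun H => f (H :&: M)) = (\sum_(G in powerset M) f G) / 2 ^+ #|M|.
Proof.
have fibre G : G \in powerset M -> \sum_(H | H :&: M == G) f (H :&: M) = f G * 2 ^+ #|~: M|.
  rewrite inE => GM.
  rewrite (eq_bigr (fun=> f G)) => [|H /eqP-> //].
  rewrite (eq_bigl (fun H => H \in [set H | H :&: M == G])); last by move=> H; rewrite inE.
  rewrite sumr_const -[f G *+ _]mulr_natr -natrX -card_powerset; congr (_ * _%:R).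
  rewrite -(card_in_imset (f := fun H : {set T} => H :\: M)) => [|H1 H2].
    apply: eq_card => H; apply/imsetP/idP => [[H1 _ ->]|].
      by rewrite inE; apply/subsetP => e; rewrite !inE => /andP[].
    rewrite inE => /subsetP HM; exists (G :|: H).
      rewrite inE; apply/eqP/setP => e; rewrite !inE.
      have := HM e; have := subsetP GM e; rewrite inE.
      by case: (e \in G) (e \in H) (e \in M) => [] [] [] //; do ?[move/(_ isT)]; move=> // _ /(_ isT).
    apply/setP => e; rewrite !inE.
    have := HM e; have := subsetP GM e; rewrite inE.
    by case: (e \in G) (e \in H) (e \in M) => [] [] [] //; do ?[move/(_ isT)]; move=> // _ /(_ isT).
  rewrite !inE => /eqP E1 /eqP E2 E3.
  by rewrite -(setID H1 M) -(setID H2 M) E1 E2 E3.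
rewrite /Ex (partition_big (fun H => H :&: M) (mem (powerset M))) /=; last first.
  by move=> H _; rewrite inE subsetIr.
rewrite (eq_bigr (fun G => f G * 2 ^+ #|~: M|)); last by move=> G /fibre.
rewrite -mulr_suml card_set_exp -(cardsC M) expnD natrM !natrX.
by rewrite -mulrA; congr (_ * _); rewrite invfM mulrCA divff ?mulr1 // expf_neq0 // pnatr_eq0.
Qed.

End RandomSet.

(** * Central binomial coefficients and the Wallis ratio *)

Section CentralBinomial.

Lemma leq_bin_central j i : ('C(j.*2, i) <= 'C(j.*2, j))%N.
Proof.
have up m : (m <= j)%N -> ('C(j.*2, m) <= 'C(j.*2, j))%N.
  move=> mj; rewrite -(subKn mj); elim: (j - m)%N => [|d IHd]; first by rewrite subn0.
  apply: leq_trans IHd; case: (ltnP d j) => [dj|jd]; last by rewrite (_ : j - d.+1 = j - d)%N //; lia.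
  have -> : (j - d)%N = (j - d.+1).+1 by lia.
  rewrite -(leq_pmul2l (ltn0Sn (j - d.+1))) mul_bin_left leq_mul2r; apply/orP; right; lia.
have [/up //|ji] := leqP i j.
have [/bin_small->//|ij] := ltnP j.*2 i.
by rewrite -bin_sub // up //; lia.
Qed.

Variable R : realFieldType.

(* The Wallis ratio C(2j,j)/4^j. *)
Definition wal (j : nat) : R := 'C(j.*2, j)%:R / 2 ^+ j.*2.

Lemma wal0 : wal 0 = 1.
Proof. by rewrite /wal bin0 expr0 divr1. Qed.

Lemma walS j : wal j.+1 * (2 * j.+1%:R) = wal j * (2 * j%:R + 1).
Proof.
have E : ('C(j.+1.*2, j.+1) * j.+1 = 2 * (j.*2.+1 * 'C(j.*2, j)))%N.
  have E1 : (j.*2.+2 * 'C(j.*2.+1, j) = j.+1 * 'C(j.*2.+2, j.+1))%N := mul_bin_diag _ _.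
  have E2 : (j.*2.+1 * 'C(j.*2, j) = j.+1 * 'C(j.*2.+1, j.+1))%N := mul_bin_diag _ _.
  have E3 : 'C(j.*2.+1, j) = 'C(j.*2.+1, j.+1).
    by rewrite -bin_sub; [congr 'C(_, _); lia | lia].
  rewrite doubleS mulnC -E1 E2 E3 mulnA; congr muln; lia.
rewrite /wal; have -> : 2 ^+ j.+1.*2 = 2 * (2 * 2 ^+ j.*2) :> R by rewrite doubleS !exprS.
have E' : ('C(j.+1.*2, j.+1)%:R * j.+1%:R = 2 * ((2 * j%:R + 1) * 'C(j.*2, j)%:R) :> R).
  by rewrite -natrM E !natrM; congr (_ * (_ * _)); rewrite -natr1 -mul2n natrM.
have p2 : (2 : R) ^+ j.*2 != 0 by rewrite expf_neq0 // pnatr_eq0.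
apply/eqP; rewrite -subr_eq0; apply/eqP.
transitivity ((('C(j.+1.*2, j.+1)%:R * j.+1%:R) - 2 * ((2 * j%:R + 1) * 'C(j.*2, j)%:R)) / (2 * 2 ^+ j.*2) : R).
  by field.
by rewrite E' subrr mul0r.
Qed.

Lemma wal_gt0 j : 0 < wal j.
Proof. by rewrite divr_gt0 ?exprn_gt0 // ltr0n bin_gt0 -addnn leq_addl. Qed.

Lemma wal_le1 j : wal j <= 1.
Proof.
elim: j => [|j IHj]; first by rewrite wal0.
have := walS j; have := wal_gt0 j.+1; have : 0 <= j%:R :> R by rewrite ler0n.
rewrite -[j.+1%:R]natr1; move: (wal j) (wal j.+1) (j%:R) IHj => x y z; nra.
Qed.

(** For odd [L], Pascal's rule gives at most two central coefficients of row [L - 1], and the extra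
    factor 2 in [2 ^+ L] compensates; hence the rounding in [L./2]. *)
Lemma bin_le_wal L i : 'C(L, i)%:R / 2 ^+ L <= wal L./2.
Proof.
rewrite -[in X in X <= _](odd_double_half L) /wal; set j := L./2.
case: (odd L); rewrite ?add0n ?add1n; last first.
  by rewrite ler_pM2r ?invr_gt0 ?exprn_gt0 // ler_nat leq_bin_central.
rewrite exprS invfM mulrA ler_pM2r ?invr_gt0 ?exprn_gt0 // ler_pdivrMr // mulr2n mulrDr mulr1.
rewrite -natrD ler_nat; case: i => [|i]; first by rewrite !bin0; have := leq_bin_central j 0; rewrite bin0; lia.
by rewrite binS leq_add // leq_bin_central.
Qed.

End CentralBinomial.

(** * Walsh characters and second moments *)

Section RandomSet.

Variables (R : realFieldType) (T : finType).
Implicit Types (M H D : {set T}).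

Lemma Pr_card_setI M j : Pr R (fun H => #|H :&: M| == j) = 'C(#|M|, j)%:R / 2 ^+ #|M|.
Proof.
rewrite /Pr (Ex_setI M (fun G => (#|G| == j)%:R)) -natr_sum -cards_draws; congr (_%:R / _).
rewrite -sum1dep_card big_mkcond [RHS]big_mkcond; apply: eq_bigr => G _.
by rewrite inE; case: (G \subset M) (#|G| == j) => [] [].
Qed.

Lemma Pr_disjoint M : Pr R (fun H => H :&: M == set0) = 1 / 2 ^+ #|M|.
Proof.
by under eq_Pr do rewrite -cards_eq0; rewrite Pr_card_setI bin0.
Qed.

Definition symd (A B : {set T}) : {set T} := [set x | (x \in A) (+) (x \in B)].

Lemma symdK B : involutive (symd^~ B).
Proof. by move=> A; apply/setP => x; rewrite !inE addbK. Qed.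

(** The Walsh characters. The link counts needed later are affine in sums of them, and orthogonality
    reduces each second moment to a number of terms. *)
Definition chi D H : R := (-1) ^+ #|D :&: H|.

Lemma chiE D H : chi D H = \prod_(e in D) (-1) ^+ (e \in H).
Proof.
rewrite /chi -sum1_card prodrXr; congr (_ ^+ _).
rewrite big_mkcond [RHS]big_mkcond; apply: eq_bigr => e _.
by rewrite !inE; case: (e \in D) (e \in H) => [] [].
Qed.

Lemma chiM D1 D2 H : chi D1 H * chi D2 H = chi (symd D1 D2) H.
Proof.
rewrite !chiE ![\prod_(e in _) _]big_mkcond -big_split; apply: eq_bigr => e _ /=.
by rewrite inE; case: (e \in D1) (e \in D2) (e \in H) => [] [] []; rewrite /= ?expr1 ?expr0 ?mulr1 ?mul1r ?mulrNN ?mulr1.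
Qed.

(** Toggling one element of a nonempty [D] preserves the measure and reverses the sign, so the mean
    equals its own opposite. *)
Lemma Ex_chi D : Ex (chi D) = (D == set0)%:R.
Proof.
have [->|/set0Pn[e eD]] := eqVneq D set0.
  rewrite (eq_Ex (g := fun=> 1)) ?Ex_cst ?card_set_gt0 // => H.
  by rewrite /chi set0I cards0.
have : Ex (fun H => chi D (symd H [set e])) = Ex (chi D) by rewrite Ex_inj //; apply: can_inj (symdK _).
rewrite (eq_Ex (g := fun H => (-1) * chi D H)) => [|H].
  rewrite ExZ mulN1r => /eqP; rewrite eq_sym -addr_eq0 -mulr2n mulrn_eq0 /=.
  by move=> /eqP.
rewrite !chiE (bigD1 e) //= [in RHS](bigD1 e) //= mulrA; congr (_ * _).
  by rewrite !inE eqxx; case: (e \in H); rewrite /= ?expr1 ?expr0 ?mulr1 ?mulrNN ?mulr1.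
by apply: eq_bigr => x /andP[_ /negPf xe]; rewrite !inE xe addbF.
Qed.

Lemma Ex_sum_chi_sq (I : finType) (A : {set I}) (F : I -> {set T}) :
    {in A &, injective F} ->
  Ex (fun H => (\sum_(i in A) chi (F i) H) ^+ 2) = #|A|%:R.
Proof.
move=> F_inj.
rewrite (eq_Ex (g := fun H => \sum_(i in A) \sum_(j in A) chi (symd (F i) (F j)) H)) => [|H].
  rewrite Ex_sum -sum1_card natr_sum; apply: eq_bigr => i iA.
  rewrite Ex_sum (bigD1 i) //= Ex_chi big1 ?addr0 => [|j /andP[jA ji]].
    case: eqP => // /setP[]; move=> x; by rewrite !inE addbb.
  rewrite Ex_chi; case: eqP => // /setP E; case/eqP: ji; apply: F_inj => //.
  by apply/setP => x; have := E x; rewrite !inE; case: (x \in _) (x \in _) => [] [].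
by rewrite expr2 mulr_suml; apply: eq_bigr => i _; rewrite mulr_sumr; apply: eq_bigr => j _; rewrite chiM.
Qed.

Lemma Pr_sum_chi (I : finType) (A : {set I}) (F : I -> {set T}) a :
    {in A &, injective F} -> 0 < a ->
  Pr R (fun H => a <= `|\sum_(i in A) chi (F i) H|) <= #|A|%:R / a ^+ 2.
Proof. by move=> F_inj a0; rewrite -(Ex_sum_chi_sq F_inj); apply: chebyshev. Qed.

End RandomSet.

(** * Degrees and links *)

Section Degrees.

Variables (V : finType) (k : nat).
Implicit Types (H T : {set {set V}}) (e S : {set V}).

(* H is an arbitrary family of sets; only its members of size k+1 are counted, so that swaps and
   flips act on all families without side conditions. *)
Definition deg H (w : V) : nat := (\sum_(e : {set V} | (#|e| == k.+1) && (w \in e)) (e \in H))%N.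

Definition links (u v : V) : {set {set V}} :=
  [set S : {set V} | [&& #|S| == k, u \notin S & v \notin S]].

Lemma linksC u v : links u v = links v u.
Proof. by apply/setP => S; rewrite !inE [(u \notin S) && _]andbC. Qed.

Lemma card_links u v : u != v -> #|links u v| = 'C(#|V| - 2, k).
Proof.
move=> uv; have -> : (#|V| - 2)%N = #|~: [set u; v]|.
  by rewrite -(cardsC [set u; v]) cards2 uv addKn.
rewrite -cards_draws; apply: eq_card => S; rewrite !inE andbC; congr andb.
apply/andP/subsetP => [[uS vS] x xS|S_uv].
  by rewrite !inE; apply/norP; split; [apply: contraNneq uS => <- | apply: contraNneq vS => <-].
by split; apply/negP => /S_uv; rewrite !inE eqxx ?orbT.
Qed.

Lemma deg_eq H H' w :
  (forall e, #|e| = k.+1 -> w \in e -> (e \in H) = (e \in H')) -> deg H w = deg H' w.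
Proof. by move=> HH'; apply: eq_bigr => e /andP[/eqP ek we]; rewrite HH'. Qed.

End Degrees.

(** * Exchanging two vertices inside a chosen set of links *)

Section Swap.

Variables (R : realFieldType) (V : finType) (k : nat) (u v : V).
Hypothesis uv : u != v.
Implicit Types (H T : {set {set V}}) (e S : {set V}).

Local Notation deg := (deg k).
Local Notation D := (links k u v).

(** [T] is consulted at the part of [e] outside [u] and [v], which the transposition does not
    change; an edge and its image obey the same decision, which makes the map an involution. *)
Definition swap_edge T e : {set V} :=
  if e :\: [set u; v] \in T then tperm u v @: e else e.

Definition swap T H : {set {set V}} := [set e | swap_edge T e \in H].

Lemma in_tperm x e : (x \in tperm u v @: e) = (tperm u v x \in e).
Proof. by rewrite -{1}(tpermK u v x) (mem_imset _ _ perm_inj). Qed.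

Lemma tperm_edgeK e : tperm u v @: (tperm u v @: e) = e.
Proof. by apply/setP => x; rewrite !in_tperm tpermK. Qed.

Lemma tperm_edgeD e : (tperm u v @: e) :\: [set u; v] = e :\: [set u; v].
Proof.
apply/setP => x; rewrite !inE negb_or in_tperm.
by case: (tpermP u v x) => [->|->|_ _]; rewrite ?eqxx ?andbF.
Qed.

Lemma swap_edgeK T : involutive (swap_edge T).
Proof.
move=> e; rewrite {2}/swap_edge; case: ifP => [eT|eT]; last by rewrite /swap_edge eT.
by rewrite /swap_edge tperm_edgeD eT tperm_edgeK.
Qed.

Lemma swapK T : involutive (swap T).
Proof. by move=> H; apply/setP => e; rewrite !inE swap_edgeK. Qed.

Lemma card_swap_edge T e : #|swap_edge T e| = #|e|.
Proof. by rewrite /swap_edge; case: ifP => // _; rewrite card_imset //; apply: perm_inj. Qed.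

Lemma deg_swap_other T H w : w != u -> w != v -> deg (swap T H) w = deg H w.
Proof.
move=> wu wv; rewrite /deg (reindex_inj (inv_inj (swap_edgeK T))) /=.
apply: eq_big => [e|e _]; last by rewrite inE swap_edgeK.
rewrite card_swap_edge /swap_edge; case: ifP => // _.
by rewrite in_tperm tpermD // eq_sym.
Qed.

Definition codeg H : nat :=
  (\sum_(e : {set V} | [&& #|e| == k.+1, u \in e & v \in e]) (e \in H))%N.

Definition both H : {set {set V}} := [set S in D | (u |: S \in H) && (v |: S \in H)].
Definition link_set H : {set {set V}} := [set S in D | u |: S \in H].
(* Only the sets of [mixed H] contribute to deg u - deg v, and a swap of T toggles the role of u and v
   exactly on the mixed sets lying in T. *)
Definition mixed H : {set {set V}} := [set S in D | (u |: S \in H) (+) (v |: S \in H)].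

Lemma codeg_swap T H : codeg (swap T H) = codeg H.
Proof.
apply: eq_bigr => e /and3P[_ ue ve]; rewrite inE /swap_edge; case: ifP => // _.
suff -> : tperm u v @: e = e by [].
apply/setP => x; rewrite in_tperm.
by case: (tpermP u v x) => [->|->|//]; rewrite ue ve.
Qed.

Lemma sum_edges_split (F : {set V} -> nat) :
  (\sum_(e : {set V} | (#|e| == k.+1) && (u \in e)) F e =
   \sum_(e : {set V} | [&& #|e| == k.+1, u \in e & v \in e]) F e + \sum_(S in D) F (u |: S))%N.
Proof.
rewrite (bigID (fun e => v \in e)) /=; congr addn; first by apply: eq_bigl => e; rewrite andbA.
rewrite (reindex_onto (fun S => u |: S) (fun e => e :\ u)) /=; last first.
  by move=> e /andP[/andP[_ ue] _]; rewrite setD1K.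
apply: eq_bigl => S; rewrite !inE eqxx /= andbT negb_or [v == u]eq_sym (negPf uv) /=.
case uS: (u \in S) => /=.
  rewrite andbF; apply/negP => /andP[_ /eqP/setP/(_ u)]; by rewrite !inE eqxx uS.
by rewrite cardsU1 uS add1n eqSS setU1K ?uS // eqxx andbT.
Qed.

Lemma degE H : deg H u = (codeg H + #|link_set H|)%N.
Proof.
rewrite /deg (sum_edges_split (fun e => (e \in H) : nat)); congr addn.
rewrite -sum1_card [RHS](eq_bigl (fun S => (S \in D) && (u |: S \in H))).
  by rewrite [RHS]big_mkcondr; apply: eq_bigr => S _; case: (_ \in H).
by move=> S; rewrite inE.
Qed.

Lemma swap_edge_link T S : S \in D -> swap_edge T (u |: S) = if S \in T then v |: S else u |: S.
Proof.
rewrite inE => /and3P[_ uS vS]; rewrite /swap_edge.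
have -> : (u |: S) :\: [set u; v] = S.
  apply/setP => x; rewrite !inE negb_or.
  by case: eqVneq => [->|_]; rewrite /= ?(negPf uS) //; case: eqVneq => [->|_]; rewrite /= ?(negPf vS).
case: ifP => // _; apply/setP => x; rewrite in_tperm !inE.
case: (tpermP u v x) => [->|->|/eqP/negPf-> /eqP/negPf->] //.
  by rewrite eq_sym (negPf uv) (negPf vS) (negPf uS).
by rewrite !eqxx.
Qed.

(** Links in [both] count for [u] whatever [T] is; a mixed link counts according to its side xor its
    membership in [T]. For uniform [T] the degree of [u] is a constant plus a fair binomial variable
    with one trial per mixed link. *)
Lemma deg_swap T H :
  deg (swap T H) u = (codeg H + #|both H| + #|symd T (link_set H) :&: mixed H|)%N.
Proof.
rewrite degE codeg_swap -addnA; congr addn.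
rewrite -cardsUI (_ : _ :&: (_ :&: _) = set0) ?cards0 ?addn0; last first.
  apply/setP => S; rewrite !inE; case: (u |: S \in H) (v |: S \in H) => [] [] //=; by rewrite ?andbF.
apply: eq_card => S; rewrite [LHS]inE; case SD: (S \in D); last first.
  by rewrite !inE; move: SD; rewrite inE => ->; rewrite andbF.
rewrite [X in _ && X]inE swap_edge_link // !inE; move: SD; rewrite inE => -> /=.
by case: (S \in T); case: (u |: S \in H) (v |: S \in H) => [] [].
Qed.

Lemma swap_avg (F : {set {set V}} -> R) : Ex F = Ex (fun H => Ex (fun T => F (swap T H))).
Proof.
transitivity (Ex (fun T => Ex (fun H => F (swap T H)))); last first.
  by rewrite /Ex -!mulr_suml exchange_big.
rewrite -[LHS](Ex_cst (card_set_gt0 {set V})); apply: eq_Ex => T.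
by rewrite Ex_inj //; apply: inv_inj (swapK T).
Qed.

(** For fixed [H] the event forces the binomial part of the degree of [u] to hit one value that does
    not depend on [T], and no value is likelier than the Wallis ratio. The side condition [g]
    survives as a factor. *)
Lemma Pr_swap (X g : pred {set {set V}}) (c : {set {set V}} -> nat) :
    (forall H T, X (swap T H) -> g H /\ deg (swap T H) u = c H) ->
  Pr R X <= Ex (fun H => (g H)%:R * wal R #|mixed H|./2).
Proof.
move=> Xgc; rewrite /Pr swap_avg; apply: ler_Ex => H.
(* The required size of the random mixed part; the truncated subtraction is exact whenever [X]
   holds, by [deg_swap]. *)
apply: le_trans (ler_wpM2l (ler0n _ _) (bin_le_wal R _ (c H - (codeg H + #|both H|)))).
rewrite -Pr_card_setI -(Ex_inj _ (inv_inj (symdK (link_set H)))) -ExZ.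
apply: ler_Ex => T; case XT: (X _); last by rewrite mulr_ge0 ?ler0n.
have [-> <-] := Xgc _ _ XT.
by rewrite deg_swap addKn /= symdK eqxx mulr1.
Qed.

End Swap.

(** * Probability that two degrees agree *)

Section EqualDegrees.

Variables (V : finType) (k : nat) (u v : V).
Hypothesis uv : u != v.
Implicit Types (H T : {set {set V}}) (e S : {set V}).

Local Notation deg := (deg k).
Local Notation D := (links k u v).
Local Notation swap := (swap u v).
Local Notation mixed := (mixed k u v).
Local Notation link := (link_set k u v).

(** The codegree and the links in [both] contribute equally to the two degrees, so equality means
    that [u] owns exactly half of the mixed links. *)
Lemma deg_eqE H : (deg H u == deg H v) = (#|link H :&: mixed H|.*2 == #|mixed H|).
Proof.
have link_both : #|link H| = (#|both k u v H| + #|link H :&: mixed H|)%N.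
  rewrite -cardsUI (_ : _ :&: (_ :&: _) = set0) ?cards0 ?addn0; last first.
    by apply/setP => S; rewrite !inE; case: (u |: S \in H) (v |: S \in H) => [] [] //=; rewrite ?andbF.
  apply: eq_card => S; rewrite !inE.
  by case: (#|S| == k) (u \notin S) (v \notin S) (u |: S \in H) (v |: S \in H) => [] [] [] [] [].
have link_both' : #|link_set k v u H| = (#|both k u v H| + #|mixed H :\: link H|)%N.
  rewrite -cardsUI (_ : _ :&: (_ :\: _) = set0) ?cards0 ?addn0; last first.
    by apply/setP => S; rewrite !inE; case: (u |: S \in H) (v |: S \in H) => [] [] //=; rewrite ?andbF.
  apply: eq_card => S; rewrite !inE.
  by case: (#|S| == k) (u \notin S) (v \notin S) (u |: S \in H) (v |: S \in H) => [] [] [] [] [].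
have codegC : codeg k v u H = codeg k u v H.
  by apply: eq_bigl => e; rewrite [(v \in e) && _]andbC.
rewrite (degE _ uv) (@degE _ _ v u) 1?eq_sym // codegC link_both link_both'.
rewrite !eqn_add2l -(cardsID (link H) (mixed H)) [mixed H :&: _]setIC -addnn eqn_add2l eq_sym.
by rewrite eq_sym.
Qed.

Lemma swap_edge_link' T S : S \in D -> swap_edge u v T (v |: S) = if S \in T then u |: S else v |: S.
Proof.
move=> SD; have := swap_edge_link uv T SD; case: ifP => [ST <-|ST _]; first by rewrite swap_edgeK.
move: SD; rewrite inE /swap_edge => /and3P[_ uS vS].
have -> : (v |: S) :\: [set u; v] = S; last by rewrite ST.
apply/setP => x; rewrite !inE negb_or.
by case: eqVneq => [->|_]; rewrite /= ?(negPf uS) //; case: eqVneq => [->|_]; rewrite /= ?(negPf vS).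
Qed.

Lemma mixed_swap T H : mixed (swap T H) = mixed H.
Proof.
apply/setP => S; rewrite [LHS]inE [RHS]inE; case SD: (S \in D) => //=.
rewrite !(in_set (fun e => swap_edge u v T e \in H)) (swap_edge_link uv _ SD) (swap_edge_link' _ SD).
by case: (S \in T); rewrite // addbC.
Qed.

Lemma link_swap T H : link (swap T H) :&: mixed H = symd T (link H) :&: mixed H.
Proof.
apply/setP => S; rewrite ![S \in _ :&: _]in_setI [S \in symd _ _]inE ![S \in link _]inE ![S \in mixed _]inE.
case SD: (S \in D); rewrite /= ?andbF //.
rewrite !(in_set (fun e => swap_edge u v T e \in H)) (swap_edge_link uv _ SD).
by case: (S \in T); case: (u |: S \in H) (v |: S \in H) => [] [].
Qed.

Lemma set_link_inj : {in D &, injective (fun S => [set u |: S; v |: S])}.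
Proof.
move=> S1 S2; rewrite !inE => /and3P[_ uS1 vS1] /and3P[_ uS2 vS2] /setP/(_ (u |: S1)).
rewrite !inE eqxx /= => /esym/orP[] /eqP; first by move=> E; rewrite -(setU1K uS1) E setU1K.
by move=> /setP/(_ u); rewrite !inE eqxx (negPf uv) (negPf uS2).
Qed.

Variable R : realFieldType.

(** The character of a pair of edges is -1 exactly when one and only one of them is present. *)
Lemma mixed_chi H :
  \sum_(S in D) chi R [set u |: S; v |: S] H = #|D|%:R - 2 * #|mixed H|%:R.
Proof.
have -> : #|mixed H|%:R = \sum_(S in D) ((u |: S \in H) (+) (v |: S \in H))%:R :> R.
  rewrite -sum1_card natr_sum [LHS](eq_bigl (fun S => (S \in D) && ((u |: S \in H) (+) (v |: S \in H)))).
    by rewrite [LHS]big_mkcondr; apply: eq_bigr => S _; case: (_ (+) _).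
  by move=> S; rewrite inE.
rewrite -sum1_card natr_sum mulr_sumr -sumrB; apply: eq_bigr => S; rewrite inE => /and3P[_ uS vS].
rewrite chiE big_setU1 ?big_set1 /=; last first.
  rewrite inE; apply/negP => /eqP/setP/(_ u); by rewrite !inE eqxx (negPf uv) (negPf uS).
by case: (u |: S \in H) (v |: S \in H) => [] []; rewrite /= ?expr0 ?expr1; lra.
Qed.

Lemma Pr_mixed (a : R) : 0 < a ->
  Pr R (fun H => a <= `|#|D|%:R - 2 * #|mixed H|%:R|) <= #|D|%:R / a ^+ 2.
Proof.
move=> a0; rewrite (@eq_Pr R _ _ (fun H => a <= `|\sum_(S in D) chi R [set u |: S; v |: S] H|)).
  exact: Pr_sum_chi set_link_inj a0.
by move=> H; rewrite mixed_chi.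
Qed.

(** Both [g] and the mixed set are constant under swaps, so averaging over [T] replaces the event by
    the exact probability that a fair binomial variable equals half its number of trials, which is 0
    for an odd number. *)
Lemma Ex_deg_eq (g : {set {set V}} -> R) : (forall T H, g (swap T H) = g H) ->
  Ex (fun H => (deg H u == deg H v)%:R * g H) =
  Ex (fun H => (if odd #|mixed H| then 0 else wal R #|mixed H|./2) * g H).
Proof.
move=> g_swap; rewrite (swap_avg u v); apply: eq_Ex => H.
rewrite (eq_Ex (g := fun T => g H * (#|symd T (link H) :&: mixed H|.*2 == #|mixed H|)%:R)); last first.
  by move=> T; rewrite g_swap mulrC deg_eqE mixed_swap link_swap.
rewrite ExZ mulrC (Ex_inj (fun T => (#|T :&: mixed H|.*2 == #|mixed H|)%:R) (inv_inj (symdK (link H)))).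
congr (_ * _); case: ifP => [odd_m|/negbT even_m].
  rewrite (eq_Ex (g := fun=> 0)) ?Ex_cst ?card_set_gt0 // => T.
  by case: eqP => // E; move: odd_m; rewrite -E odd_double.
rewrite /wal (even_halfK even_m) -Pr_card_setI; apply: eq_Ex => T; congr (nat_of_bool _)%:R.
by rewrite -[in LHS](even_halfK even_m); apply/eqP/eqP => [/double_inj//|->].
Qed.

Definition flip e H : {set {set V}} := symd H [set e].

Lemma flip_inj e : injective (flip e).
Proof. exact: inv_inj (symdK _). Qed.

Lemma mixed_flip S H : S \in D -> mixed (flip (u |: S) H) = symd (mixed H) [set S].
Proof.
move=> SD; apply/setP => S'; rewrite [LHS]inE [RHS]inE [S' \in mixed H]inE.
rewrite !(in_set (fun x => (x \in H) (+) (x \in [set u |: S]))) !in_set1.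
move: (SD); rewrite inE => /and3P[_ uS vS].
have vSuS S1 : S1 \in D -> (v |: S1 == u |: S) = false.
  rewrite inE => /and3P[_ uS1 _]; apply/negP => /eqP/setP/(_ u).
  by rewrite !inE eqxx (negPf uv) (negPf uS1).
have [->|SS'] := eqVneq S' S; first by rewrite SD vSuS //= eqxx addbF addbT addNb addbT.
rewrite addbF; case S'D: (S' \in D) => //=; rewrite vSuS // addbF.
case: eqP => [E|_]; last by rewrite addbF.
move: S'D; rewrite inE => /and3P[_ uS' _].
by case/eqP: SS'; rewrite -(setU1K uS') E setU1K.
Qed.

Lemma card_symd1 (T : finType) (A : {set T}) x :
  #|symd A [set x]| = (if x \in A then #|A|.-1 else #|A|.+1).
Proof.
case: ifP => xA.
  rewrite (cardsD1 x A) xA /=; apply: eq_card => y; rewrite !inE.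
  by case: eqVneq => [->|_]; rewrite ?xA ?addbF.
have -> : #|A|.+1 = #|x |: A| by rewrite cardsU1 xA.
by apply: eq_card => y; rewrite !inE; case: eqVneq => [->|_]; rewrite ?xA ?addbF.
Qed.

Let phi L : R := if odd L then 0 else wal R L./2.

(** The two mixed counts differ by one, so exactly one of them is even and contributes; [j] is half
    of that even count. *)
Lemma phi_flip S H : S \in D -> exists j,
  phi #|mixed H| + phi #|mixed (flip (u |: S) H)| = wal R j /\
  `|2 * #|mixed H|%:R - 4 * j%:R| <= 2 :> R.
Proof.
move=> SD; rewrite mixed_flip // card_symd1 /phi; set L := #|mixed H|.
have LE := odd_double_half L.
have [L' -> L'E] : exists2 L', (if S \in mixed H then L.-1 else L.+1) = L' &
    (L' = L.+1 \/ L = L'.+1).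
  case: ifP => SM; last by exists L.+1; auto.
  have : (0 < L)%N by apply/card_gt0P; exists S.
  by case: L {LE} => // m _; exists m; auto.
have L'odd : odd L' = ~~ odd L by case: L'E => ->; rewrite /= ?negbK.
have bound j : (j.*2 <= L.+1)%N -> (L <= j.*2.+1)%N -> `|2 * L%:R - 4 * j%:R| <= 2 :> R.
  move=> h1 h2.
  have {}h1 : 2 * j%:R <= L%:R + 1 :> R by rewrite natr1 -natrM ler_nat mul2n.
  have {}h2 : L%:R <= 2 * j%:R + 1 :> R by rewrite -natrM natr1 ler_nat mul2n.
  by rewrite ler_norml; apply/andP; split; lra.
rewrite L'odd; case Lodd: (odd L) => /=.
  exists L'./2; rewrite add0r; split=> //.
  by apply: bound; move: Lodd L'odd L'E; lia.
by exists L./2; rewrite addr0; split=> //; apply: bound; move: Lodd LE; lia.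
Qed.

Lemma phi01 L : 0 <= phi L <= 1.
Proof. by rewrite /phi; case: ifP => _; rewrite ?lexx ?ler01 // ltW ?wal_gt0 ?wal_le1. Qed.

(** Averaging a family with its flip removes the parity effect and leaves half of one Wallis ratio.
    Its index is near [#|D| / 4] unless the mixed count is exceptional, which Chebyshev bounds by
    [#|D| / a ^+ 2]; [beta] is the approximate value of the ratio. *)
Lemma Ex_deg_eq_approx (g : {set {set V}} -> R) S (beta eps a : R) :
    S \in D -> (forall T H, g (swap T H) = g H) ->
    (forall H, g (flip (u |: S) H) = g H) -> (forall H, 0 <= g H <= 1) ->
    0 <= beta <= 1 -> 0 < a -> 0 <= eps ->
    (forall j, `|#|D|%:R - 4 * j%:R| < a + 2 -> `|wal R j - beta| <= eps) ->
  `|Ex (fun H => (deg H u == deg H v)%:R * g H) - beta / 2 * Ex g|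
    <= (eps + #|D|%:R / a ^+ 2) / 2.
Proof.
move=> SD g_swap g_flip g01 beta01 a0 eps0 wal_beta.
rewrite Ex_deg_eq // -/phi.
have -> : Ex (fun H => phi #|mixed H| * g H) - beta / 2 * Ex g =
    2^-1 * Ex (fun H => (phi #|mixed H| + phi #|mixed (flip (u |: S) H)| - beta) * g H).
  rewrite [in RHS](eq_Ex (g := fun H => (phi #|mixed H| * g H
      + phi #|mixed (flip (u |: S) H)| * g (flip (u |: S) H)) - beta * g H)); last first.
    by move=> H; rewrite g_flip; ring.
  rewrite ExB ExD ExZ (Ex_inj (fun H => phi #|mixed H| * g H) (@flip_inj _)).
  by lra.
rewrite normrM ger0_norm ?invr_ge0 // [leRHS]mulrC ler_wpM2l ?invr_ge0 //.
apply: le_trans (ler_norm_Ex _) _.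
have h : Ex (fun H => `|(phi #|mixed H| + phi #|mixed (flip (u |: S) H)| - beta) * g H|) <=
    Ex (fun H => eps + (a <= `|#|D|%:R - 2 * #|mixed H|%:R|)%R%:R).
  apply: ler_Ex => H; rewrite normrM; have /andP[g0 g1] := g01 H.
  rewrite (ger0_norm g0); apply: le_trans (ler_piMr (normr_ge0 _) g1) _.
  have [j [-> jL]] := phi_flip H SD.
  case: (leP a _) => [_|La].
    have := wal_le1 R j; have := wal_gt0 R j; move=> w0 w1; rewrite /=.
    by case/andP: beta01 => b0 b1; rewrite ler_norml; apply/andP; split; lra.
  rewrite addr0 wal_beta //; move: La jL; rewrite !ltr_norml ler_norml.
  by move=> /andP[h1 h2] /andP[h3 h4]; apply/andP; split; lra.
apply: le_trans h _; by rewrite ExD Ex_cst ?card_set_gt0 // lerD2l Pr_mixed.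
Qed.

(** An upper bound only, so parity does not matter. As soon as more than a quarter of the links are
    mixed, [j = #|mixed H|./2] satisfies [#|D| <= 8 * j + 4]; Chebyshev gives [4 / #|D|] for the
    contrary case. Keeping [g] allows the estimate to be iterated. *)
Lemma Pr_anticoncentration (X g : pred {set {set V}}) (c : {set {set V}} -> nat) (b : R) :
    (0 < #|D|)%N -> 0 <= b -> (forall j, (#|D| <= 8 * j + 4)%N -> wal R j <= b) ->
    (forall H T, X (swap T H) -> g H /\ deg (swap T H) u = c H) ->
  Pr R X <= 4 / #|D|%:R + b * Pr R g.
Proof.
move=> D0 b0 wal_b Xgc; apply: le_trans (Pr_swap R uv Xgc) _.
have D0' : 0 < #|D|%:R :> R by rewrite ltr0n.
have h : Ex (fun H => (g H)%:R * wal R #|mixed H|./2) <=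
    Ex (fun H => ((#|D|%:R : R) / 2 <= `|#|D|%:R - 2 * #|mixed H|%:R|)%R%:R + b * (g H)%:R).
  apply: ler_Ex => H; case: (leP (#|D|%:R / 2) _) => [_|DL].
    case: (g H); last by rewrite mul0r mulr0 addr0 ler01.
    rewrite [in leLHS]mul1r [b * _]mulr1.
    by apply: le_trans (wal_le1 R _) _; rewrite lerDl.
  rewrite add0r mulrC; apply: ler_wpM2r; first exact: ler0n.
  apply: wal_b; have : (#|D| < 4 * #|mixed H|)%N.
    rewrite -(ltr_nat R) natrM; move: DL; rewrite ltr_norml => /andP[h1 h2]; lra.
  by have := odd_double_half #|mixed H|; lia.
apply: le_trans h _; rewrite ExD ExZ lerD2r.
apply: le_trans (Pr_mixed _) _; first by rewrite divr_gt0.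
by rewrite le_eqVlt; apply/orP; left; apply/eqP; field; rewrite lt0r_neq0.
Qed.

End EqualDegrees.

(** * Counting pairs of equal degrees *)

Section Coincidences.

Variables (V : finType) (k : nat).
Implicit Types (H : {set {set V}}) (A : {set V}) (u v w : V).

Local Notation deg := (deg k).

Definition pairs A : {set V * V} :=
  [set p | [&& p.1 \in A, p.2 \in A & (enum_rank p.1 < enum_rank p.2)%N]].

Definition coincidences A H : nat :=
  (\sum_(p in pairs A) (deg H p.1 == deg H p.2))%N.

Lemma eq_coincidences A H H' :
  {in A, deg H =1 deg H'} -> coincidences A H = coincidences A H'.
Proof.
move=> HH'; apply: eq_bigr => -[x y]; rewrite inE => /and3P[/= xA yA _].
by rewrite !HH'.
Qed.

Lemma neq_rank u v : (u != v) = (enum_rank u < enum_rank v)%N || (enum_rank v < enum_rank u)%N.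
Proof. by rewrite -neq_ltn (inj_eq (@ord_inj _)) (inj_eq enum_rank_inj). Qed.

Lemma coincidences_gt0P A H : (0 < coincidences A H)%N <->
  exists u v, [/\ u \in A, v \in A, u != v & deg H u = deg H v].
Proof.
rewrite lt0n sum_nat_eq0 negb_forall; split.
  case/existsP => -[u v]; rewrite negb_imply inE /= => /andP[/and3P[uA vA uv]].
  by rewrite eqb0 negbK => /eqP duv; exists u, v; split=> //; rewrite neq_rank uv.
case=> u [v [uA vA + duv]]; rewrite neq_rank => /orP[] uv; apply/existsP.
  by exists (u, v); rewrite negb_imply inE /= uA vA uv duv eqxx.
by exists (v, u); rewrite negb_imply inE /= uA vA uv duv eqxx.
Qed.

(** If no third vertex of [A] shares the common degree, the pair counts once and every other
    coincidence avoids both vertices. *)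
Lemma coincidencesD2 A H u v : u \in A -> v \in A -> u != v -> deg H u = deg H v ->
    {in A :\ u :\ v, forall w, deg H w != deg H u} ->
  coincidences A H = (coincidences (A :\ u :\ v) H).+1.
Proof.
wlog: u v / (enum_rank u < enum_rank v)%N => [hwlog uA vA uv duv nd|ltuv uA vA uv duv nd].
  move: (uv); rewrite neq_rank => /orP[] ltuv; first exact: hwlog.
  rewrite setDDl setUC -setDDl; apply: hwlog => //; first by rewrite eq_sym.
  by move=> w; rewrite setDDl setUC -setDDl -duv => /nd.
rewrite /coincidences (bigD1 (u, v)) /=; last by rewrite inE /= uA vA ltuv.
rewrite duv eqxx add1n; congr _.+1.
rewrite big_mkcond [RHS]big_mkcond; apply: eq_bigr => -[x y] _ /=.
rewrite !inE /= xpair_eqE.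
case xA: (x \in A); case yA: (y \in A); rewrite ?andbF //=.
case ltxy: (enum_rank x < enum_rank y)%N; rewrite ?andbF //= !andbT.
have ndx w : w \in A -> w != u -> w != v -> (deg H w == deg H v) = false.
  by move=> wA wu wv; rewrite -duv; apply: negbTE; apply: nd; rewrite !inE wu wv.
have [xu|xu] /= := eqVneq x u.
  have [yv|yv] /= := eqVneq y v; first by rewrite ?andbF.
  have yu : y != u by apply: contraTneq ltxy => ->; rewrite xu ltnn.
  by rewrite xu duv eq_sym ndx // ?andbF.
have [xv|xv] /= := eqVneq x v.
  have yv : y != v by apply: contraTneq ltxy => ->; rewrite xv ltnn.
  have yu : y != u by apply: contraTneq ltxy => ->; rewrite xv -leqNgt ltnW.
  by rewrite xv eq_sym ndx.
have [yv|yv] /= := eqVneq y v; first by rewrite yv ndx.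
by have [yu|yu] //= := eqVneq y u; rewrite yu duv ndx.
Qed.

Lemma coincidencesD2_eq A H u v : u \in A -> v \in A ->
    {in A, forall w, w != u -> deg H w != deg H u} ->
    {in A, forall w, w != v -> deg H w != deg H v} ->
  coincidences A H = coincidences (A :\ u :\ v) H.
Proof.
move=> uA vA ndu ndv.
rewrite /coincidences big_mkcond [RHS]big_mkcond; apply: eq_bigr => -[x y] _ /=.
rewrite !inE /=.
case xA: (x \in A); case yA: (y \in A); rewrite ?andbF //=.
case ltxy: (enum_rank x < enum_rank y)%N; rewrite ?andbF //= !andbT.
have xy : x != y by rewrite neq_rank ltxy.
have yx : y != x by rewrite eq_sym.
have [xv|xv] /= := eqVneq x v.
  by rewrite xv eq_sym (negPf (ndv y _ _)) // -xv.
have [xu|xu] /= := eqVneq x u.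
  by rewrite xu eq_sym (negPf (ndu y _ _)) // -xu.
have [yv|yv] /= := eqVneq y v; first by rewrite yv (negPf (ndv x _ _)).
by have [yu|yu] //= := eqVneq y u; rewrite yu (negPf (ndu x _ _)).
Qed.

End Coincidences.

(** * Stein's identity for the number of coincidences *)

Section Stein.

Variables (R : realFieldType) (V : finType) (k : nat) (b : R).
Implicit Types (H : {set {set V}}) (A : {set V}) (u v w : V).

Local Notation deg := (deg k).
Let N := 'C(#|V| - 2, k).
Hypothesis N_gt0 : (0 < N)%N.
Hypothesis b_ge0 : 0 <= b.
Hypothesis wal_le_b : forall j, (N <= 8 * j + 4)%N -> wal R j <= b.

(** One application of anticoncentration bounds a pair of equal degrees by [q1], a second one bounds
    a triple by [q2]; each loses [4 / N%:R] to Chebyshev. *)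
Let q1 : R := 4 / N%:R + b.
Let q2 : R := 4 / N%:R + b * q1.

Lemma q1_ge0 : 0 <= q1.
Proof. by rewrite addr_ge0 // divr_ge0 ?ler0n. Qed.

(** [u] is swapped with an auxiliary vertex [x] rather than with [v]: the degree of [v] stays fixed
    and serves as the target value. *)
Lemma Pr_deg_eq2 u v x : u != v -> x != u -> x != v ->
  Pr R (fun H => deg H u == deg H v) <= q1.
Proof.
move=> uv xu xv; have ux : u != x by rewrite eq_sym.
apply: le_trans (@Pr_anticoncentration V k u x ux R _ predT (fun H => deg H v) b _ b_ge0 _ _) _.
- by rewrite card_links.
- by move=> j; rewrite card_links //; apply: wal_le_b.
- by move=> H T /eqP ->; split=> //; rewrite deg_swap_other // eq_sym.
rewrite card_links // /q1 lerD2l ler_piMr //; exact: Pr_le1 (card_set_gt0 _) _.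
Qed.

Lemma Pr_deg_eq3 u v w x : uniq [:: u; v; w; x] ->
  Pr R (fun H => (deg H u == deg H v) && (deg H w == deg H v)) <= q2.
Proof.
rewrite /= !inE !negb_or -!andbA ?andbT => /and5P[uv uw ux vw /andP[vx wx]].
have [vu wu xu wv [xv xw]] : [/\ v != u, w != u, x != u, w != v & x != v /\ x != w].
  by split; [..|split]; rewrite eq_sym.
apply: le_trans (@Pr_anticoncentration V k u x ux R _ (fun H => deg H w == deg H v) (fun H => deg H v) b _ b_ge0 _ _) _.
- by rewrite card_links.
- by move=> j; rewrite card_links //; apply: wal_le_b.
- by move=> H T /andP[/eqP -> ]; rewrite !deg_swap_other.
rewrite card_links // /q2 lerD2l ler_wpM2l //; exact: (@Pr_deg_eq2 w v x).
Qed.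

Variables (A S0 : {set V}) (f : nat -> R).
Hypotheses (S0k : #|S0| = k) (k_gt0 : (0 < k)%N) (AS0 : [disjoint A & S0]).
Hypothesis f01 : forall m, 0 <= f m <= 1.
Local Notation Z := (coincidences k A).

Lemma f_dist m1 m2 (B : bool) : (~~ B -> m1 = m2) -> `|f m1 - f m2| <= B%:R.
Proof.
case: B => [_|/(_ isT)->]; last by rewrite subrr normr0.
have /andP[a0 a1] := f01 m1; have /andP[b0 b1] := f01 m2.
by rewrite ler_norml; apply/andP; split; rewrite /=; lra.
Qed.

Lemma spare : exists2 x, (x \in S0) & (forall w, w \in A -> x != w).
Proof.
have /card_gt0P[x xS0] : (0 < #|S0|)%N by rewrite S0k.
exists x => // w wA; apply: contraTneq wA => <-.
by move: AS0; rewrite disjoint_sym => /disjointFr ->.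
Qed.

Variables (beta eps a : R).
Hypotheses (beta01 : 0 <= beta <= 1) (a0 : 0 < a) (eps0 : 0 <= eps).
Hypothesis wal_beta : forall j, `|N%:R - 4 * j%:R| < a + 2 -> `|wal R j - beta| <= eps.

Let err : R := #|A|%:R * q2 + (eps + N%:R / a ^+ 2) / 2 + beta * #|A|%:R * q1.

(** [g] counts only coincidences avoiding [u] and [v], so it is unchanged by their swaps and by the
    flip of [u |: S0], and [Ex_deg_eq_approx] applies to it. Replacing [f (Z H)] by [g] on the event
    costs a third equal degree, at most [q2] per vertex; replacing [g] by [f (Z H).+1] costs another
    coincidence at [u] or [v], at most [q1] per vertex. *)
Lemma stein_pair u v : u \in A -> v \in A -> u != v ->
  `|Ex (fun H => (deg H u == deg H v)%:R * f (Z H)) - beta / 2 * Ex (fun H => f (Z H).+1)| <= err.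
Proof.
move=> uA vA uv; have [x xS0 xA] := spare.
have xu := xA u uA; have xv := xA v vA.
have vu : v != u by rewrite eq_sym.
pose A' := A :\ u :\ v; pose g H := f (coincidences k A' H).+1.
have A'A w : w \in A' -> [/\ w \in A, w != u & w != v] by rewrite !inE => /and3P[].
have h1 : `|Ex (fun H => (deg H u == deg H v)%:R * f (Z H)) - Ex (fun H => (deg H u == deg H v)%:R * g H)|
    <= #|A|%:R * q2.
  rewrite -ExB; apply: le_trans (ler_norm_Ex _) _.
  have [B hB hle] : exists2 B : pred {set {set V}},
      (forall H, `|(deg H u == deg H v)%:R * f (Z H) - (deg H u == deg H v)%:R * g H| <= (B H)%:R)
      & Pr R B <= #|A|%:R * q2.
    exists (fun H => [exists w in A', (deg H u == deg H v) && (deg H w == deg H v)]).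
      move=> H; case: eqP => [duv|_]; last by rewrite !mul0r subrr normr0 ler0n.
      rewrite !mul1r; apply: f_dist => /existsPn nd.
      apply: coincidencesD2 => // w wA'; have := nd w.
      by rewrite wA' /= duv.
    apply: le_trans (_ : #|A'|%:R * q2 <= _); last first.
      rewrite ler_wpM2r ?addr_ge0 ?divr_ge0 ?ler0n ?mulr_ge0 ?q1_ge0 //.
      by rewrite ler_nat subset_leq_card //; apply/subsetP => w /A'A[].
    apply: (ler_Pr_sum_cst (D := mem A') (Q := fun w H => (deg H u == deg H v) && (deg H w == deg H v))).
      by move=> H /existsP[w /andP[wA' hw]]; exists w.
    move=> w /A'A[wA wu wv]; apply: (@Pr_deg_eq3 u v w x).
    by rewrite /= !inE !negb_or uv ![_ == x]eq_sym xu xv (xA w wA) ![_ == w]eq_sym wu wv.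
  exact: le_trans (ler_Ex hB) hle.
have h3 : `|Ex g - Ex (fun H => f (Z H).+1)| <= 2 * #|A|%:R * q1.
  rewrite -ExB; apply: le_trans (ler_norm_Ex _) _.
  pose B1 H := [exists w in A :\ u, deg H w == deg H u].
  pose B2 H := [exists w in A :\ v, deg H w == deg H v].
  have hB H : `|g H - f (Z H).+1| <= (B1 H)%:R + (B2 H)%:R.
    apply: (@le_trans _ _ ((B1 H || B2 H)%:R)); last first.
      by rewrite -natrD ler_nat; case: (B1 H) (B2 H) => [] [].
    apply: f_dist; rewrite negb_or => /andP[/existsPn nd1 /existsPn nd2]; congr _.+1; apply/esym.
    apply: coincidencesD2_eq => // w wA wu.
      by have := nd1 w; rewrite !inE wA wu.
    by have := nd2 w; rewrite !inE wA wu.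
  have PrB y y' : y \in A -> y' \in A -> y != y' ->
      Pr R (fun H => [exists w in A :\ y, deg H w == deg H y]) <= #|A|%:R * q1.
    move=> yA y'A yy'.
    apply: le_trans (_ : #|A :\ y|%:R * q1 <= _); last first.
      by rewrite ler_wpM2r ?q1_ge0 // ler_nat subset_leq_card // subsetDl.
    apply: (ler_Pr_sum_cst (D := mem (A :\ y)) (Q := fun w H => deg H w == deg H y)).
      by move=> H /existsP[w /andP[wA' hw]]; exists w.
    by move=> w /setD1P[wy wA]; apply: (@Pr_deg_eq2 w y x); rewrite ?xA.
  apply: le_trans (ler_Ex hB) _; rewrite ExD.
  have := PrB u v uA vA uv; have := PrB v u vA uA vu; rewrite /Pr -/(B1 _) => e1 e2.
  by move: (lerD e2 e1); rewrite /B1 /B2; lra.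
have h2 : `|Ex (fun H => (deg H u == deg H v)%:R * g H) - beta / 2 * Ex g|
    <= (eps + N%:R / a ^+ 2) / 2.
  have S0D : S0 \in links k u v.
    by rewrite inE S0k eqxx (disjointFr AS0 uA) (disjointFr AS0 vA).
  rewrite -[N](card_links k uv).
  apply: (@Ex_deg_eq_approx _ _ _ _ uv _ _ S0) => //.
  - move=> T H; congr (f _.+1); apply: eq_coincidences => w /A'A[_ wu wv].
    by rewrite deg_swap_other.
  (* The flipped edge [u |: S0] contains no vertex of [A'], because [A] is disjoint from [S0]. *)
  - move=> H; congr (f _.+1); apply: eq_coincidences => w /A'A[wA wu _].
    apply: deg_eq => e _ we; rewrite !inE; case: eqP => [E|_]; last by rewrite addbF.
    by move: we; rewrite E !inE (negPf wu) (disjointFr AS0 wA).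
  - by move=> H; apply: f01.
  - by move=> j; rewrite card_links //; apply: wal_beta.
have h3' : `|beta / 2 * Ex g - beta / 2 * Ex (fun H => f (Z H).+1)| <= beta * #|A|%:R * q1.
  have /andP[be0 _] := beta01.
  rewrite -mulrBr normrM ger0_norm ?divr_ge0 //.
  apply: le_trans (ler_wpM2l _ h3) _; first by rewrite divr_ge0.
  by rewrite le_eqVlt; apply/orP; left; apply/eqP; field.
move: h1 h2 h3'; rewrite /err.
move: (Ex _) (Ex (fun H => _ * g H)) (beta / 2 * Ex g) (beta / 2 * Ex _) => y1 y2 y3 y4.
rewrite !ler_norml => /andP[? ?] /andP[? ?] /andP[? ?]; apply/andP; split; lra.
Qed.

Lemma stein : 
  `|Ex (fun H => (Z H)%:R * f (Z H)) - #|pairs A|%:R * (beta / 2) * Ex (fun H => f (Z H).+1)|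
    <= #|pairs A|%:R * err.
Proof.
rewrite (eq_Ex (g := fun H => \sum_(p in pairs A) (deg H p.1 == deg H p.2)%:R * f (Z H))); last first.
  by move=> H; rewrite natr_sum mulr_suml.
rewrite Ex_sum -mulrA !mulr_natl -!sumr_const -sumrB.
apply: le_trans (ler_norm_sum _ _ _) _; apply: ler_sum => -[u v].
by rewrite inE => /and3P[/= uA vA ltuv]; apply: stein_pair => //; rewrite neq_rank ltuv.
Qed.

End Stein.

(** * Deterministic construction of a weighting with two weights *)

Section TwoWeighting.

Variables (V : finType) (H : {set {set V}}).
Implicit Types (F : {set {set V}}) (e S : {set V}) (u v x y : V).

Definition color F x : nat := (\sum_(e in H | x \in e) (1 + (e \in F)))%N.

(** A vertex of [S] lies in both edges, so moving the extra weight from [v |: S] to [u |: S] cancels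
    there; only [u] gains 1 and [v] loses 1. The additive form avoids subtraction in [nat]. *)
Lemma color_exchange F u v S : u != v -> u \notin S -> v \notin S ->
    u |: S \in H -> v |: S \in H -> u |: S \notin F -> v |: S \in F ->
  forall x, (color (u |: S |: F :\ (v |: S)) x + (x == v) = color F x + (x == u))%N.
Proof.
move=> uv uS vS uSH vSH uSF vSF x; set F' := _ |: _.
have neq : (v |: S == u |: S) = false.
  by apply/negP => /eqP/setP/(_ u); rewrite !inE eqxx (negPf uv) (negPf uS).
have sum1 e0 : e0 \in H -> (\sum_(e in H | x \in e) (e == e0) = (x \in e0))%N.
  move=> e0H; case xe0: (x \in e0).
    rewrite (bigD1 e0) /= ?e0H ?xe0 // eqxx big1 ?addn0 // => e /andP[_ /negPf-> //].
  rewrite big1 // => e /andP[_ xe]; case: eqP => // E; by rewrite E xe0 in xe.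
have split_mem y : y \notin S -> (x \in y |: S : nat) = ((x == y) + (x \in S))%N.
  move=> yS; rewrite !inE; case: eqVneq => [->|] //=; by rewrite (negPf yS).
suff : (color F' x + (x \in v |: S) = color F x + (x \in u |: S))%N.
  by rewrite !split_mem // !addnA => /addIn.
rewrite -!sum1 // -!big_split /=; apply: eq_bigr => e _; rewrite !inE.
case: (eqVneq e (u |: S)) => [->|eu] /=; first by rewrite eq_sym neq (negPf uSF).
by case: eqVneq => [->|ev] //=; rewrite vSF.
Qed.

Lemma color_exchanges F u v (s : seq {set V}) : u != v -> uniq s ->
    {in s, forall S, [/\ u \notin S, v \notin S & [/\ u |: S \in H, v |: S \in H, u |: S \notin F & v |: S \in F]]} ->
  exists F', (forall x, (color F' x + size s * (x == v) = color F x + size s * (x == u))%N) /\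
    (forall e, {in s, forall S, (e != u |: S) && (e != v |: S)} -> (e \in F') = (e \in F)).
Proof.
move=> uv; elim: s F => [|S s IHs] F /=; first by exists F; split=> // x; rewrite !mul0n.
move=> /andP[Ss s_uniq] good.
have [uS vS [uSH vSH uSF vSF]] := good S (mem_head _ _).
set F1 := u |: S |: F :\ (v |: S).
have good1 : {in s, forall S', [/\ u \notin S', v \notin S' & [/\ u |: S' \in H, v |: S' \in H, u |: S' \notin F1 & v |: S' \in F1]]}.
  move=> S' S's; have [uS' vS' [uS'H vS'H uS'F vS'F]] := good S' (mem_behead (s := S :: s) S's).
  split=> //; split=> //; rewrite !inE.
    rewrite (negPf uS'F) andbF orbF; apply: contraNneq Ss => E.
    by rewrite -(setU1K uS) -E setU1K.
  rewrite vS'F andbT; apply/orP; right; apply: contraNneq Ss => E.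
  by rewrite -(setU1K vS) -E setU1K.
have [F' [colF' F'F1]] := IHs F1 s_uniq good1.
exists F'; split=> [x|e se].
  have := colF' x; have := color_exchange uv uS vS uSH vSH uSF vSF x; rewrite -/F1.
  rewrite !mulSn; lia.
have /andP[eu ev] := se S (mem_head _ _).
rewrite F'F1; first by rewrite !inE (negPf eu) ev.
by move=> S' S's; apply: se; rewrite inE S's orbT.
Qed.

Lemma avoid (s : seq nat) : exists2 t, (t <= size s)%N & t \notin s.
Proof.
have [/allP sub|] := boolP (all (fun t => t \in s) (iota 0 (size s).+1)).
  by have := uniq_leq_size (iota_uniq 0 (size s).+1) sub; rewrite size_iota ltnn.
by case/allPn => t; rewrite mem_iota add0n => /andP[_ ts] tns; exists t.
Qed.

Variables (m : nat) (idx : V -> nat) (u v : nat -> V) (Q : nat -> {set {set V}}).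
Hypothesis idx_u : forall i, (i < m)%N -> idx (u i) = i.
Hypothesis idx_v : forall i, (i < m)%N -> idx (v i) = i.
Hypothesis uv : forall i, (i < m)%N -> u i != v i.
Hypothesis idxP : forall x, (idx x < m)%N -> x = u (idx x) \/ x = v (idx x).
Hypothesis idx_rest : forall x y, (m <= idx x)%N -> (m <= idx y)%N -> x = y.
Hypothesis QH : forall i S, (i < m)%N -> S \in Q i ->
  [/\ u i \notin S, v i \notin S, u i |: S \in H & v i |: S \in H].
Hypothesis Q_disj : forall i j S S' x y, (i < m)%N -> (j < m)%N -> i != j ->
  S \in Q i -> S' \in Q j -> idx x = i -> idx y = j -> x |: S != y |: S'.
Hypothesis Q_big : forall i, (i < m)%N -> (2 * #|V| <= #|Q i|)%N.

(** Pairs are settled one at a time: [t] exchanges raise [u i] and lower [v i] by [t] and change no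
    other color, so [t] has to avoid fewer than [2 * #|V|] values. By [Q_disj], edges reserved for
    later pairs keep their initial weights. By [idx_rest] at most one vertex is outside the pairs;
    it counts as settled from the start. *)
Lemma greedy_coloring : exists F, injective (color F).
Proof.
suff /(_ m (leqnn m)) [F [injF _]] : forall i, (i <= m)%N -> exists F,
    {in [pred x | (idx x < i)%N || (m <= idx x)%N] &, injective (color F)} /\
    (forall j S, (i <= j < m)%N -> S \in Q j -> u j |: S \notin F /\ v j |: S \in F).
  exists F => x y; apply: injF; rewrite inE; by case: ltnP.
elim=> [_|i IHi im].
  (* Initially the heavy edges are the reserved ones on the [v] side, so every exchange is available
     in the direction from [v j] to [u j]. *)
  exists [set e | [exists j : 'I_m, exists S in Q j, e == v j |: S]]; split.
    by move=> x y /=; rewrite !inE /= => mx my _; apply: idx_rest.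
  move=> j S /andP[_ jm] SQ; split; rewrite inE; last first.
    by apply/existsP; exists (Ordinal jm); apply/existsP; exists S; rewrite SQ /=.
  apply/negP => /existsP[[l lm] /existsP[S' /andP[/= S'Q /eqP E]]].
  have [jl|jl] := eqVneq j l; last first.
    by have := Q_disj jm lm jl SQ S'Q (idx_u jm) (idx_v lm); rewrite E eqxx.
  rewrite -jl in E S'Q; have [uS' _ _ _] := QH jm S'Q.
  by move/setP/(_ (u j)): E; rewrite !inE eqxx (negPf (uv jm)) (negPf uS').
have [F [injF FQ]] := IHi (ltnW im).
pose W := [seq x <- enum V | (idx x < i)%N || (m <= idx x)%N].
have memW x : (x \in W) = (idx x < i)%N || (m <= idx x)%N by rewrite mem_filter mem_enum andbT.
pose cu := color F (u i); pose cv := color F (v i).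
pose bad := ((cv - cu)./2 :: [seq color F x - cu | x <- W] ++ [seq cv - color F x | x <- W])%N.
have [t t_le t_bad] := avoid bad.
have tQ : (t <= #|Q i|)%N.
  apply: leq_trans (leq_trans t_le _) (Q_big im).
  rewrite /bad /= size_cat !size_map.
  suff : (size W < #|V|)%N by move: (size W) #|V| => a b; lia.
  rewrite cardE size_filter -(count_predC (fun x => (idx x < i)%N || (m <= idx x)%N) (enum V)).
  rewrite -[X in (X < _)%N]addn0 ltn_add2l -has_count; apply/hasP.
  by exists (u i); rewrite ?mem_enum //= idx_u // ltnn leqNgt im.
have [F' [colF' F'F]] : exists F', (forall x, (color F' x + t * (x == v i) = color F x + t * (x == u i))%N) /\
    (forall e, {in Q i, forall S, (e != u i |: S) && (e != v i |: S)} -> (e \in F') = (e \in F)).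
  have size_s : size (take t (enum (Q i))) = t by rewrite size_takel // -cardE.
  have sub_s S : S \in take t (enum (Q i)) -> S \in Q i by move/mem_take; rewrite mem_enum.
  have [|S /sub_s SQ|F' [h1 h2]] := @color_exchanges F (u i) (v i) (take t (enum (Q i))) (uv im).
  - by rewrite take_uniq // enum_uniq.
  - have [a1 a2 a3 a4] := QH im SQ; have [|b1 b2] := FQ i S _ SQ; first by rewrite leqnn im.
    by split.
  exists F'; rewrite size_s in h1; split=> // e he; apply: h2 => S /sub_s; exact: he.
exists F'; split; last first.
  move=> j S /andP[ij jm] SQ; have [|b1 b2] := FQ j S _ SQ; first by rewrite ltnW.
  have ji : j != i by rewrite gtn_eqF.
  rewrite !F'F // => S' S'Q; rewrite ?(Q_disj jm im ji SQ S'Q) //; by rewrite ?idx_u ?idx_v.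
have vu : v i != u i by rewrite eq_sym uv.
have colu : color F' (u i) = (cu + t)%N.
  by have := colF' (u i); rewrite eqxx (negPf (uv im)) muln0 muln1 addn0.
have colv : (color F' (v i) + t)%N = cv.
  by have := colF' (v i); rewrite eqxx (negPf vu) muln0 muln1 addn0.
have colW x : x \in W -> color F' x = color F x.
  rewrite memW => xW; have := colF' x.
  have [xu|xu] := eqVneq x (u i); first by move: xW; rewrite xu idx_u // ltnn leqNgt im.
  have [xv|xv] := eqVneq x (v i); first by move: xW; rewrite xv idx_v // ltnn leqNgt im.
  by rewrite !muln0 !addn0.
have bad_u x : x \in W -> color F' x != color F' (u i).
  move=> xW; rewrite colW // colu; apply: contraNneq t_bad => E.
  rewrite !inE mem_cat; apply/orP; right; apply/orP; left; apply/mapP; exists x => //; lia.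
have bad_v x : x \in W -> color F' x != color F' (v i).
  move=> xW; rewrite colW //; apply: contraNneq t_bad => E.
  rewrite !inE mem_cat; apply/orP; right; apply/orP; right; apply/mapP; exists x => //; lia.
have bad_uv : color F' (u i) != color F' (v i).
  rewrite colu; apply: contraNneq t_bad => E; rewrite !inE; apply/orP; left; apply/eqP; lia.
have casesW x : (idx x < i.+1)%N || (m <= idx x)%N -> [\/ x \in W, x = u i | x = v i].
  rewrite memW ltnS leq_eqVlt -orbA => /orP[/eqP xi|->]; last by constructor 1.
  by have [] := @idxP x; rewrite ?xi //; [constructor 2|constructor 3].
move=> x y /casesW[xW|->|->] /casesW[yW|->|->] E //.
- by apply: injF; rewrite -?colW // inE -memW.
- by have := bad_u x xW; rewrite E eqxx.
- by have := bad_v x xW; rewrite E eqxx.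
- by have := bad_u y yW; rewrite E eqxx.
- by rewrite E eqxx in bad_uv.
- by have := bad_v y yW; rewrite E eqxx.
- by rewrite E eqxx in bad_uv.
Qed.

End TwoWeighting.

(** * From random families of sets to uniform hypergraphs *)

Section Hypergraphs.

Variables (R : realFieldType) (n k : nat).
Implicit Types (H : {set {set 'I_n}}) (x y : 'I_n).

Definition layer : {set {set 'I_n}} := [set e : {set 'I_n} | #|e| == k.+1].

(** The trace of a uniform family on the sets of size [k.+1] is a uniform hypergraph, so all
    estimates can be made on unrestricted families. *)
Lemma Pr_uniform (P : pred {set {set 'I_n}}) :
  #|[set H | uniform k.+1 H && P H]|%:R / 2 ^+ 'C(n, k.+1) = Pr R (fun H => P (H :&: layer)).
Proof.
rewrite /Pr (Ex_setI layer (fun H => (P H)%:R)) /layer card_draws card_ord; congr (_ / _).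
rewrite -natr_sum -sum1dep_card; congr _%:R.
rewrite big_mkcond [RHS]big_mkcond; apply: eq_bigr => H _.
have -> : (H \in powerset [set e : {set 'I_n} | #|e| == k.+1]) = uniform k.+1 H.
  rewrite inE; apply/subsetP/forallP => [sub e|unif e eH].
    by apply/implyP => /sub; rewrite inE.
  by have := unif e; rewrite eH inE.
by case: (uniform _ _); case: (P H).
Qed.

Lemma deg_layer H : deg k (H :&: layer) =1 deg k H.
Proof. by move=> x; apply: deg_eq => e ek _; rewrite !inE ek eqxx andbT. Qed.

Lemma induced_color1 H wt x : @induced_color n 1 (H :&: layer) wt x = deg k H x.
Proof.
rewrite /induced_color /deg big_mkcond [RHS]big_mkcond; apply: eq_bigr => e _.
rewrite !inE (ord1 (wt e)); case: (e \in H) (x \in e) (#|e| == k.+1) => [] [] [] //.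
Qed.

Lemma sw1P H : reflect
  (forall e x y, e \in H -> #|e| = k.+1 -> x \in e -> y \in e -> x != y -> deg k H x != deg k H y)
  (sw1 (H :&: layer)).
Proof.
apply: (iffP existsP) => [[wt /forallP str] e x y eH ek xe ye xy|dist].
  have := str e; rewrite !inE eH ek eqxx /= => /forallP/(_ x); rewrite xe /= => /forallP/(_ y).
  by rewrite ye xy /= !induced_color1.
exists [ffun=> ord0]; apply/forallP => e; apply/implyP; rewrite !inE => /andP[eH /eqP ek].
apply/forallP => x; apply/implyP => xe; apply/forallP => y; apply/implyP => ye.
by apply/implyP => xy; rewrite !induced_color1; apply: dist xe ye xy.
Qed.

Lemma sw2_color H F : injective (color (H :&: layer) F) -> strongly_weighted 2 (H :&: layer).
Proof.
move=> injF; pose wt := [ffun e => if e \in F then ord_max else ord0 : 'I_2].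
have colE x : @induced_color n 2 (H :&: layer) wt x = color (H :&: layer) F x.
  by apply: eq_bigr => e _; rewrite ffunE; case: (e \in F).
apply/existsP; exists wt; apply/forallP => e; apply/implyP => _.
apply/forallP => x; apply/implyP => _; apply/forallP => y; apply/implyP => _.
by apply/implyP; apply: contraNneq; rewrite !colE => /injF->.
Qed.

Definition common x y : {set {set 'I_n}} := [set e : {set 'I_n} | [&& #|e| == k.+1, x \in e & y \in e]].

Lemma card_common x y : (0 < k)%N -> x != y -> #|common x y| = 'C(n - 2, k.-1).
Proof.
move=> k0 xy; have -> : (n - 2)%N = #|~: [set x; y]|.
  by rewrite -[n in LHS]card_ord -(cardsC [set x; y]) cards2 xy addKn.
rewrite -cards_draws -(card_in_imset (f := fun S => x |: (y |: S))); last first.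
  move=> S1 S2; rewrite !inE => /andP[/subsetP S1xy _] /andP[/subsetP S2xy _].
  have nS (S : {set 'I_n}) : {subset S <= ~: [set x; y]} -> (x \notin S) * (y \notin S).
    by move=> sub; split; apply/negP => /sub; rewrite !inE eqxx ?orbT.
  have n1 := nS S1 S1xy; have n2 := nS S2 S2xy; move=> /setP E.
  apply/setP => z; have := E z; rewrite !inE.
  have [->|_] := eqVneq z x; first by rewrite (negPf n1.1) (negPf n2.1).
  by have [->|_] := eqVneq z y; first by rewrite (negPf n1.2) (negPf n2.2).
apply: eq_card => e; apply/idP/imsetP => [|[S]]; rewrite !inE.
  case/and3P => /eqP ek xe ye; exists (e :\: [set x; y]).
    rewrite inE; apply/andP; split; first by apply/subsetP => z; rewrite !inE => /andP[].
    have := cardsID [set x; y] e; rewrite (setIidPr _) ?cards2 ?xy ?ek; first by move/(congr1 (subn^~ 2%N)); rewrite addKn => ->; apply/eqP; lia.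
    by apply/subsetP => z; rewrite !inE => /orP[] /eqP->.
  apply/setP => z; rewrite !inE negb_or.
  have [->|_] //= := eqVneq z x; by have [->|_] //= := eqVneq z y.
case/andP => /subsetP sub /eqP Sk ->.
have xS : x \notin S by apply/negP => /sub; rewrite !inE eqxx.
have yS : y \notin S by apply/negP => /sub; rewrite !inE eqxx orbT.
rewrite !inE !eqxx !orbT /= !andbT !cardsU1 !inE negb_or xy xS yS Sk; apply/eqP; lia.
Qed.

Lemma Pr_no_common x y : (0 < k)%N -> x != y ->
  Pr R (fun H => [forall e in H, e \notin common x y]) = 1 / 2 ^+ 'C(n - 2, k.-1).
Proof.
move=> k0 xy; rewrite -(card_common k0 xy) -Pr_disjoint; apply: eq_Pr => H.
apply/forallP/eqP => [nc|/setP nc e].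
  by apply/setP => e; rewrite !in_set0 in_setI; apply/negP => /andP[eH ec]; have := nc e; rewrite eH ec.
by apply/implyP => eH; have := nc e; rewrite in_set0 in_setI eH /= => ->.
Qed.

(** With one weight, equal degrees are tolerated only between vertices without a common edge; the
    second term is the union bound over such pairs. *)
Lemma Pr_sw1_le A : (0 < k)%N ->
  Pr R (fun H => sw1 (H :&: layer)) <=
    Pr R (fun H => coincidences k A H == 0%N) + n%:R ^+ 2 * (1 / 2 ^+ 'C(n - 2, k.-1)).
Proof.
move=> k0; pose B H := [exists p : 'I_n * 'I_n, (p.1 != p.2) && [forall e in H, e \notin common p.1 p.2]].
apply: le_trans (ler_PrU (Q1 := fun H => coincidences k A H == 0%N) (Q2 := B) _ _) _.
  move=> H /sw1P dist; apply/orP; case: (posnP (coincidences k A H)) => [_|]; first by left.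
  case/coincidences_gt0P => x [y [_ _ xy dxy]]; right; apply/existsP; exists (x, y) => /=.
  rewrite xy; apply/forallP => e; apply/implyP => eH; rewrite inE; apply/negP => /and3P[/eqP ek xe ye].
  by have := dist e x y eH ek xe ye xy; rewrite dxy eqxx.
rewrite lerD2l.
have h : Pr R B <= #|[pred p : 'I_n * 'I_n | p.1 != p.2]|%:R * (1 / 2 ^+ 'C(n - 2, k.-1)).
  apply: (ler_Pr_sum_cst (Q := fun p H => [forall e in H, e \notin common p.1 p.2])).
    by move=> H /existsP[p /andP[pp hp]]; exists p.
  by move=> p pp; rewrite Pr_no_common.
apply: le_trans h _; rewrite ler_wpM2r ?divr_ge0 ?exprn_ge0 //.
by rewrite -natrX ler_nat; apply: leq_trans (max_card _) _; rewrite card_prod card_ord.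
Qed.

Section PairBound.

Variable q : R.
Hypothesis q_ge0 : 0 <= q.
Hypothesis Pr_pair : forall x y, x != y -> Pr R (fun H => deg k H x == deg k H y) <= q.

(** Coincidences involving a vertex of [S0] are invisible inside the complement and are paid for by
    a union bound. *)
Lemma Pr_coincidences0_le (S0 : {set 'I_n}) :
  Pr R (fun H => coincidences k (~: S0) H == 0%N) <=
    Pr R (fun H => sw1 (H :&: layer)) + #|S0|%:R * n%:R * q.
Proof.
pose D := [pred p : 'I_n * 'I_n | (p.1 \in S0) && (p.1 != p.2)].
pose B H := [exists p in D, deg k H p.1 == deg k H p.2].
apply: le_trans (ler_PrU (Q1 := fun H => sw1 (H :&: layer)) (Q2 := B) _ _) _.
  move=> H /eqP Z0; apply/orP; have [?|/negP nB] := boolP (B H); [by right|left].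
  apply/sw1P => e x y _ _ _ _ xy; apply/negP => /eqP dxy.
  have [xS|xS] := boolP (x \in S0).
    by apply: nB; apply/existsP; exists (x, y); rewrite inE /= xS xy dxy eqxx.
  have [yS|yS] := boolP (y \in S0).
    by apply: nB; apply/existsP; exists (y, x); rewrite inE /= yS eq_sym xy dxy eqxx.
  suff : (0 < coincidences k (~: S0) H)%N by rewrite Z0.
  by apply/coincidences_gt0P; exists x, y; rewrite !inE.
rewrite lerD2l.
have h : Pr R B <= #|D|%:R * q.
  apply: (ler_Pr_sum_cst (Q := fun p H => deg k H p.1 == deg k H p.2)).
    by move=> H /existsP[p /andP[pD hp]]; exists p.
  by move=> p /andP[_ pp]; apply: Pr_pair.
apply: le_trans h _; rewrite ler_wpM2r // -natrM ler_nat.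
have <- : #|setX S0 [set: 'I_n]| = (#|S0| * n)%N by rewrite cardsX cardsT card_ord.
apply: subset_leq_card.
by apply/subsetP => p; rewrite !inE => /andP[-> _].
Qed.

Lemma Pr_nsw1_le : Pr R (fun H => ~~ sw1 (H :&: layer)) <= n%:R ^+ 2 * q.
Proof.
pose D := [pred p : 'I_n * 'I_n | p.1 != p.2].
have h : Pr R (fun H => ~~ sw1 (H :&: layer)) <= #|D|%:R * q.
  apply: (ler_Pr_sum_cst (Q := fun p H => deg k H p.1 == deg k H p.2)).
    move=> H ns; have [/existsP[p /andP[pD hp]]|/existsPn nB] :=
      boolP [exists p, D p && (deg k H p.1 == deg k H p.2)]; first by exists p.
    case/negP: ns; apply/sw1P => e x y _ _ _ _ xy.
    by have := nB (x, y); rewrite /= xy.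
  by move=> p; apply: Pr_pair.
apply: le_trans h _; rewrite ler_wpM2r // -natrX ler_nat.
by apply: leq_trans (max_card _) _; rewrite card_prod card_ord.
Qed.

End PairBound.

End Hypergraphs.

(** * A random hypergraph offers enough exchanges *)

Section RandomTwoWeighting.

Variables (R : realFieldType) (n' k : nat).
Local Notation n := n'.+1.
Implicit Types (H : {set {set 'I_n}}) (x y : 'I_n).

Let u i : 'I_n := inord i.*2.
Let v i : 'I_n := inord i.*2.+1.

Lemma val_u i : (i < n./2)%N -> u i = i.*2 :> nat.
Proof. by move=> i2; rewrite inordK //; have := odd_double_half n; lia. Qed.

Lemma val_v i : (i < n./2)%N -> v i = i.*2.+1 :> nat.
Proof. by move=> i2; rewrite inordK //; have := odd_double_half n; lia. Qed.

(** Vertices are paired as 2i, 2i+1, and links for pair [i] use only pairs of the other parity.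
    Pairs of equal parity then use different edges since neither pair meets the links of the other;
    pairs of opposite parity do so because their links lie in disjoint vertex sets and, for
    [k >= 2], have at least two elements. *)
Definition opposite (i : nat) : {set 'I_n} := [set x : 'I_n | odd (x : nat)./2 != odd i].
Definition opposite_links (i : nat) : {set {set 'I_n}} := [set S : {set 'I_n} | (S \subset opposite i) && (#|S| == k)].
Definition exchangeable H i : {set {set 'I_n}} :=
  [set S in opposite_links i | (u i |: S \in H) && (v i |: S \in H)].

(** Each complete block of four consecutive vertices holds two pairs of opposite parity, hence
    contributes two vertices. *)
Lemma leq_card_opposite i : ((n %/ 4).*2 <= #|opposite i|)%N.
Proof.
pose f (j : 'I_(n %/ 4).*2) : 'I_n := inord (4 * (j : nat)./2 + 2 * ~~ odd i + odd j).
have fE j : f j = (4 * (j : nat)./2 + 2 * ~~ odd i + odd j)%N :> nat.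
  rewrite inordK //; have := ltn_ord j; have := divn_eq n 4; case: (odd i); case: (odd j); lia.
rewrite -[X in (X <= _)%N]card_ord -cardsT -(card_imset (f := f)); last first.
  move=> j1 j2 /(congr1 val) /=; rewrite !fE => E; apply: val_inj => /=.
  move: E; case: (odd i); lia.
apply: subset_leq_card; apply/subsetP => x /imsetP[j _ ->]; rewrite inE fE.
by case: (odd i) => /=; apply/eqP; lia.
Qed.

Lemma card_opposite_links i : #|opposite_links i| = 'C(#|opposite i|, k).
Proof. by rewrite /opposite_links cards_draws. Qed.

Lemma opposite_linksP i S : (i < n./2)%N -> S \in opposite_links i -> S \in links k (u i) (v i).
Proof.
move=> i2; rewrite !inE => /andP[/subsetP sub ->] /=.
apply/andP; split; apply/negP => /sub; rewrite inE ?val_u ?val_v //.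
  by rewrite doubleK eqxx.
by rewrite /= uphalf_double eqxx.
Qed.

Lemma sw2_exchangeable H : (2 <= k)%N ->
    (forall i, (i < n./2)%N -> (2 * n <= #|exchangeable H i|)%N) ->
  strongly_weighted 2 (H :&: layer n k).
Proof.
move=> k2 big; have half_n := odd_double_half n.
have ltord x : (x < n)%N := ltn_ord x.
have [||||||||F injF] := @greedy_coloring _ (H :&: layer n k) n./2 (fun x => (x : nat)./2) u v (exchangeable H).
- by move=> i i2; rewrite val_u // doubleK.
- by move=> i i2; rewrite val_v //= uphalf_double.
- by move=> i i2; apply/eqP => /(congr1 val) /=; rewrite val_u // val_v //; lia.
- move=> x x2; have := odd_double_half x; case: (odd x) => xE; [right|left]; apply: val_inj; rewrite /= ?val_u ?val_v //.
- by move=> x y x2 y2; apply: val_inj => /=; have := ltord x; have := ltord y; lia.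
- move=> i S i2; rewrite inE => /andP[SP /andP[uS vS]].
  have := opposite_linksP i2 SP; rewrite inE => /and3P[/eqP Sk uiS viS].
  by rewrite !inE uS vS !cardsU1 uiS viS Sk !eqxx.
- move=> i j S S' x y i2 j2 ij; rewrite !inE => /andP[/andP[/subsetP sub /eqP Sk] _].
  move=> /andP[/andP[/subsetP sub' _] _] xi yj; apply/eqP => E.
  have [pij|pij] := eqVneq (odd i) (odd j).
    have : x \in y |: S' by rewrite -E !inE eqxx.
    rewrite !inE => /orP[/eqP xy|/sub']; last by rewrite inE xi pij eqxx.
    by move: ij; rewrite -xi -yj xy eqxx.
  have /subset_leq_card : S \subset [set y].
    apply/subsetP => z zS; have : z \in y |: S' by rewrite -E !inE zS orbT.
    rewrite !inE => /orP[//|/sub']; have := sub z zS; rewrite !inE.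
    by move: pij; case: (odd i) (odd j) (odd (z : nat)./2) => [] [] [].
  by rewrite cards1 Sk; lia.
- by move=> i i2; rewrite card_ord; apply: big.
exact: sw2_color injF.
Qed.

(** The product of [1 - chi] over the two edges is 4 if both are present and 0 otherwise; this is
    its expansion. *)
Lemma exchangeable_chi H i : (i < n./2)%N ->
  4 * #|exchangeable H i|%:R = #|opposite_links i|%:R
    - \sum_(S in opposite_links i) chi R [set u i |: S] H
    - \sum_(S in opposite_links i) chi R [set v i |: S] H
    + \sum_(S in opposite_links i) chi R [set u i |: S; v i |: S] H.
Proof.
move=> i2; have -> : #|exchangeable H i|%:R =
    \sum_(S in opposite_links i) ((u i |: S \in H) && (v i |: S \in H))%:R :> R.
  rewrite -sum1_card natr_sum.
  rewrite [LHS](eq_bigl (fun S => (S \in opposite_links i) && ((u i |: S \in H) && (v i |: S \in H)))).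
    by rewrite [LHS]big_mkcondr; apply: eq_bigr => S _; case: (_ && _).
  by move=> S; rewrite inE.
rewrite -sum1_card natr_sum mulr_sumr -!sumrB -big_split; apply: eq_bigr => S SP /=.
have := opposite_linksP i2 SP; rewrite inE => /and3P[_ uS vS].
rewrite !chiE big_setU1 ?big_set1 /=; last first.
  rewrite inE; apply/negP => /eqP/setP/(_ (u i)); rewrite !inE eqxx (negPf uS) /= orbF.
  by move/esym/eqP/(congr1 val) => /=; rewrite val_u // val_v //; lia.
by case: (u i |: S \in H) (v i |: S \in H) => [] []; rewrite /= ?expr0 ?expr1; lra.
Qed.

(** Each of the three character sums reaches a quarter of the number of opposite links with
    probability at most 16 over that number. Otherwise [4 * #|exchangeable H i|] keeps at least a
    quarter of it, so at least [8 * n]. *)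
Lemma Pr_exchangeable_small i : (i < n./2)%N -> (32 * n <= #|opposite_links i|)%N ->
  Pr R (fun H => (#|exchangeable H i| < 2 * n)%N) <= 48 / #|opposite_links i|%:R.
Proof.
move=> i2; set P := opposite_links i => Pn.
have P0 : 0 < #|P|%:R :> R by rewrite ltr0n; lia.
pose far (F : {set 'I_n} -> {set {set 'I_n}}) H := #|P|%:R / 4 <= `|\sum_(S in P) chi R (F S) H|.
pose F1 S := [set u i |: S]; pose F2 S := [set v i |: S]; pose F3 S := [set u i |: S; v i |: S].
have Pr_far F : {in P &, injective F} -> Pr R (far F) <= 16 / #|P|%:R.
  move=> F_inj; apply: le_trans (Pr_sum_chi F_inj _) _; first by rewrite divr_gt0.
  by rewrite le_eqVlt; apply/orP; left; apply/eqP; field; rewrite lt0r_neq0.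
have uv : u i != v i.
  by apply/eqP => /(congr1 val) /=; rewrite val_u // val_v //; lia.
have inj1 : {in P &, injective F1}.
  move=> S1 S2 /(opposite_linksP i2) + /(opposite_linksP i2); rewrite !inE => /and3P[_ h1 _] /and3P[_ h2 _].
  by move/set1_inj => E; rewrite -(setU1K h1) E setU1K.
have inj2 : {in P &, injective F2}.
  move=> S1 S2 /(opposite_linksP i2) + /(opposite_linksP i2); rewrite !inE => /and3P[_ _ h1] /and3P[_ _ h2].
  by move/set1_inj => E; rewrite -(setU1K h1) E setU1K.
have inj3 : {in P &, injective F3}.
  move=> S1 S2 /(opposite_linksP i2) + /(opposite_linksP i2); exact: (set_link_inj uv).
have h : Pr R (fun H => (#|exchangeable H i| < 2 * n)%N) <= Pr R (far F1) + (Pr R (far F2) + Pr R (far F3)).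
  apply: le_trans (ler_PrU (Q1 := far F1) (Q2 := fun H => far F2 H || far F3 H) _ _) _; last first.
    by rewrite lerD2l; apply: ler_PrU.
  move=> H; rewrite -(ltr_nat R) => small; apply/negPn; rewrite !negb_or -!ltNge.
  apply/negP => /and3P[]; rewrite !ltr_norml => /andP[a1 b1] /andP[a2 b2] /andP[a3 b3].
  have := exchangeable_chi H i2; rewrite -/P -/(F1 _).
  move: Pn; rewrite -(ler_nat R) natrM.
  move: small; rewrite natrM; rewrite /F1 /F2 /F3 in a1 b1 a2 b2 a3 b3; lra.
apply: le_trans h _; have := Pr_far _ inj1; have := Pr_far _ inj2; have := Pr_far _ inj3; lra.
Qed.

Lemma Pr_nsw2_le (K : nat) : (2 <= k)%N -> K = 'C((n %/ 4).*2, k) -> (32 * n <= K)%N ->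
  Pr R (fun H => ~~ strongly_weighted 2 (H :&: layer n k)) <= n%:R * (48 / K%:R).
Proof.
move=> k2 KE K32; have KP i : (K <= #|opposite_links i|)%N.
  by rewrite KE card_opposite_links leq_bin2l // leq_card_opposite.
have h : Pr R (fun H => ~~ strongly_weighted 2 (H :&: layer n k)) <= #|'I_(n./2)|%:R * (48 / K%:R).
  apply: (@ler_Pr_sum_cst _ _ _ predT _ (fun (i : 'I_(n./2)) H => (#|exchangeable H i| < 2 * n)%N)).
    move=> H; have [/existsP[i hi]|/existsPn hi] := boolP [exists i : 'I_(n./2), (#|exchangeable H i| < 2 * n)%N].
      by move=> _; exists i.
    move=> /negP[]; apply: sw2_exchangeable => // i i2; rewrite leqNgt; exact: (hi (Ordinal i2)).
  move=> i _; apply: le_trans (Pr_exchangeable_small (ltn_ord i) _) _.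
    exact: leq_trans (KP i).
  rewrite ler_wpM2l // lef_pV2 ?posrE ?ltr0n ?ler_nat //; first by have := KP i; lia.
  by lia.
apply: le_trans h _; rewrite card_ord ler_wpM2r ?divr_ge0 //.
by rewrite ler_nat; have := odd_double_half n; lia.
Qed.

End RandomTwoWeighting.

(** * Wallis integrals and the integrals solving Stein's equation *)

Section Integrals.

Local Open Scope R_scope.

Definition sinI (n : nat) : R := RInt (fun x => sin x ^ n) 0 (PI / 2).

Lemma ex_RInt_sin_pow n : ex_RInt (fun x => sin x ^ n) 0 (PI / 2).
Proof.
apply: ex_RInt_continuous => x _; apply: (ex_derive_continuous (fun x => sin x ^ n)).
by auto_derive.
Qed.

(** The integrated difference is the derivative of [- cos x * sin x ^ n.+1], which vanishes at both
    ends. *)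
Lemma sinI_rec n : INR n.+2 * sinI n.+2 = INR n.+1 * sinI n.
Proof.
have h : is_RInt (fun x => INR n.+2 * sin x ^ n.+2 - INR n.+1 * sin x ^ n) 0 (PI / 2)
    (minus (- cos (PI / 2) * sin (PI / 2) ^ n.+1) (- cos 0 * sin 0 ^ n.+1)).
  apply: (is_RInt_derive (fun x => - cos x * sin x ^ n.+1)) => x _.
    auto_derive => //.
    have cs := sin2_cos2 x; rewrite /Rsqr in cs.
    have cc : cos x * cos x = 1 - sin x * sin x by Lra.lra.
    rewrite -?[match n with O => _ | S _ => _ end]/(INR n.+1) !S_INR -!tech_pow_Rmult.
    transitivity (sin x * (sin x * sin x ^ n) - (INR n + 1) * (cos x * cos x) * sin x ^ n); first by Lra.lra.
    rewrite cc; Lra.lra.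
  apply: (ex_derive_continuous (fun x => INR n.+2 * sin x ^ n.+2 - INR n.+1 * sin x ^ n)).
  by auto_derive.
have h' : is_RInt (fun x => INR n.+2 * sin x ^ n.+2 - INR n.+1 * sin x ^ n) 0 (PI / 2)
    (minus (scal (INR n.+2) (sinI n.+2)) (scal (INR n.+1) (sinI n))).
  apply: is_RInt_minus; apply: is_RInt_scal; apply: RInt_correct; exact: ex_RInt_sin_pow.
have := is_RInt_unique _ _ _ _ h'; rewrite (is_RInt_unique _ _ _ _ h).
move: (INR n.+2) (INR n.+1) => p q.
rewrite /minus /plus /Hierarchy.opp /scal /= /mult /= cos_PI2 sin_0; Lra.lra.
Qed.

Lemma sinI0 : sinI 0 = PI / 2.
Proof. rewrite /sinI /= RInt_const /scal /= /mult /=; Lra.lra. Qed.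

Lemma sinI1 : sinI 1 = 1.
Proof.
rewrite /sinI; apply: is_RInt_unique.
have -> : 1 = minus (- cos (PI / 2)) (- cos 0) by rewrite /minus /plus /Hierarchy.opp /= cos_PI2 cos_0; Lra.lra.
apply: (is_RInt_derive (fun x => - cos x)) => x _; first by auto_derive => //; Lra.lra.
apply: (ex_derive_continuous (fun x => sin x ^ 1)); by auto_derive.
Qed.

Lemma sinI_le n : sinI n.+1 <= sinI n.
Proof.
have := PI_RGT_0 => pi0.
apply: RInt_le; [Lra.lra|exact: ex_RInt_sin_pow|exact: ex_RInt_sin_pow|] => x [x0 x1].
have s0 : 0 <= sin x by apply: sin_ge_0; Lra.lra.
have s1 := proj2 (SIN_bound x).
rewrite -tech_pow_Rmult -[X in _ <= X]Rmult_1_l; apply: Rmult_le_compat_r => //.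
exact: pow_le.
Qed.

Variable l : R.

(** The value at [k.+1] of the solution of Stein's equation for the Poisson law of mean [l] and the
    indicator of 0. The integral form gives the bounds 0 and 1 at once, and integration by parts
    gives the equation. *)
Definition expI (k : nat) : R := RInt (fun s => s ^ k * exp (- l * s)) 0 1.

Lemma ex_RInt_expI k : ex_RInt (fun s => s ^ k * exp (- l * s)) 0 1.
Proof.
apply: ex_RInt_continuous => x _; apply: (ex_derive_continuous (fun s => s ^ k * exp (- l * s))).
by auto_derive.
Qed.

Lemma expI_rec k : l * expI k.+1 - INR k.+1 * expI k = - exp (- l).
Proof.
have h : is_RInt (fun s => l * (s ^ k.+1 * exp (- l * s)) - INR k.+1 * (s ^ k * exp (- l * s))) 0 1
    (minus (- (1 ^ k.+1 * exp (- l * 1))) (- (0 ^ k.+1 * exp (- l * 0)))).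
  apply: (is_RInt_derive (fun s => - (s ^ k.+1 * exp (- l * s)))) => x _.
    by auto_derive => //; rewrite -?[match k with O => _ | S _ => _ end]/(INR k.+1) S_INR -tech_pow_Rmult; Lra.lra.
  apply: (ex_derive_continuous (fun s => l * (s ^ k.+1 * exp (- l * s)) - INR k.+1 * (s ^ k * exp (- l * s)))).
  by auto_derive.
have h' : is_RInt (fun s => l * (s ^ k.+1 * exp (- l * s)) - INR k.+1 * (s ^ k * exp (- l * s))) 0 1
    (minus (scal l (expI k.+1)) (scal (INR k.+1) (expI k))).
  apply: is_RInt_minus; apply: is_RInt_scal; apply: RInt_correct; exact: ex_RInt_expI.
have := is_RInt_unique _ _ _ _ h'; rewrite (is_RInt_unique _ _ _ _ h).
move: (INR k.+1) => q.
rewrite /minus /plus /Hierarchy.opp /scal /= /mult /= pow1 (Rmult_1_r (- l)) => E; Lra.lra.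
Qed.

Lemma expI0 : l * expI 0 = 1 - exp (- l).
Proof.
have h : is_RInt (fun s => l * (s ^ 0 * exp (- l * s))) 0 1
    (minus (- exp (- l * 1)) (- exp (- l * 0))).
  apply: (is_RInt_derive (fun s => - exp (- l * s))) => x _.
    by auto_derive => //=; Lra.lra.
  apply: (ex_derive_continuous (fun s => l * (s ^ 0 * exp (- l * s)))).
  by auto_derive.
have h' : is_RInt (fun s => l * (s ^ 0 * exp (- l * s))) 0 1 (scal l (expI 0)).
  apply: is_RInt_scal; apply: RInt_correct; exact: ex_RInt_expI.
have := is_RInt_unique _ _ _ _ h'; rewrite (is_RInt_unique _ _ _ _ h).
rewrite /minus /plus /Hierarchy.opp /scal /= /mult /= (Rmult_1_r (- l)) (Rmult_0_r (- l)) exp_0 => E; Lra.lra.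
Qed.

Lemma expI01 k : 0 <= l -> 0 <= expI k <= 1.
Proof.
move=> l0; have ex := ex_RInt_expI k.
have bound x : 0 < x < 1 -> 0 <= x ^ k * exp (- l * x) <= 1.
  case=> x0 x1; have p0 : 0 <= x ^ k by apply: pow_le; Lra.lra.
  have p1 : x ^ k <= 1 by rewrite -(pow1 k); apply: pow_incr; Lra.lra.
  have e0 := exp_pos (- l * x).
  have e1 : exp (- l * x) <= 1.
    rewrite -exp_0; have := Rmult_le_pos _ _ l0 (Rlt_le _ _ x0) => lx.
    by case: (Req_dec (- l * x) 0) => [->|?]; [Lra.lra|apply: Rlt_le; apply: exp_increasing; Lra.lra].
  split; first by apply: Rmult_le_pos; Lra.lra.
  by rewrite -[X in _ <= X]Rmult_1_l; apply: Rmult_le_compat; Lra.lra.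
split.
  apply: RInt_ge_0 => //; first Lra.lra.
  by move=> x /bound[].
have -> : 1 = RInt (fun=> 1) 0 1 by rewrite RInt_const /scal /= /mult /=; Lra.lra.
apply: RInt_le => //; [Lra.lra|exact: ex_RInt_const|].
by move=> x /bound[].
Qed.

End Integrals.

(** * Two-sided bounds on the Wallis ratio *)

Section Wallis.

Local Notation w := (wal R).

Lemma sinI_even j : sinI j.*2 = PI / 2 * w j.
Proof.
elim: j => [|j IHj]; first by rewrite sinI0 wal0 mulr1 -RdivE.
have := sinI_rec j.*2; rewrite IHj !INRE -doubleS RmultE => E.
have j1 : j.+1%:R != 0 :> R by rewrite pnatr_eq0.
have := walS R j => W.
have E' : 2 * j.+1%:R * sinI j.+1.*2 = (2 * j%:R + 1) * (PI / 2 * w j).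
  by move: E; rewrite RmultE -[j.+1.*2]mul2n natrM -[j.*2.+1%:R]natr1 -mul2n natrM.
apply: (mulfI (x := 2 * j.+1%:R)); first by rewrite mulf_neq0 // pnatr_eq0.
rewrite E'; have -> : 2 * j.+1%:R * (PI / 2 * w j.+1) = PI / 2 * (w j.+1 * (2 * j.+1%:R)) by ring.
by rewrite W; ring.
Qed.

Lemma sinI_odd j : (2 * j%:R + 1) * w j * sinI j.*2.+1 = 1.
Proof.
elim: j => [|j IHj]; first by rewrite sinI1 wal0 mulr0 add0r !mulr1.
have := sinI_rec j.*2.+1; rewrite !INRE !RmultE -doubleS => E.
have := walS R j => W.
have E' : (2 * j.+1%:R + 1) * sinI j.+1.*2.+1 = 2 * j.+1%:R * sinI j.*2.+1.
  by move: E; rewrite -[j.+1.*2.+1%:R]natr1 -mul2n natrM.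
transitivity (w j.+1 * ((2 * j.+1%:R + 1) * sinI j.+1.*2.+1)); first by ring.
by rewrite E' mulrA W -[RHS]IHj; ring.
Qed.

Lemma PI_gt0 : 0 < PI :> R.
Proof. by apply/RltP/PI_RGT_0. Qed.

Lemma odd_wal_ge0 j : 0 <= (2 * j%:R + 1) * w j.
Proof. by rewrite mulr_ge0 ?(ltW (wal_gt0 R j)) // addr_ge0 // mulr_ge0 // ler0n. Qed.

(** Multiplying [sinI_le] at [j.*2] by [(2 * j%:R + 1) * w j] turns the odd integral into 1; the
    upper bound uses the next index in the same way. *)
Lemma wallis_lower j : 2 <= PI * (2 * j%:R + 1) * w j ^+ 2.
Proof.
have /RleP := sinI_le j.*2; rewrite sinI_even => h.
have := ler_wpM2l (odd_wal_ge0 j) h; rewrite sinI_odd => h2.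
have -> : PI * (2 * j%:R + 1) * w j ^+ 2 = 2 * ((2 * j%:R + 1) * w j * (PI / 2 * w j)) by field.
by rewrite -[leLHS]mulr1 ler_pM2l.
Qed.

Lemma wallis_upper j : PI * j%:R * w j ^+ 2 <= 1.
Proof.
case: j => [|j]; first by rewrite mulr0 mul0r ler01.
have /RleP := sinI_le j.*2.+1; rewrite -doubleS sinI_even => h.
have := ler_wpM2l (odd_wal_ge0 j) h; rewrite sinI_odd [_ * w j]mulrC -walS => h2.
have -> : PI * j.+1%:R * w j.+1 ^+ 2 = w j.+1 * (2 * j.+1%:R) * (PI / 2 * w j.+1) by field.
exact: h2.
Qed.

End Wallis.

(** * Explicit error bounds in terms of beta *)

Section WallisConsequences.

Variables (F : realFieldType) (P beta : F) (N : nat).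
Hypotheses (P2 : 2 <= P) (P4 : P <= 4).
Hypotheses (wal_lower : forall j, 2 <= P * (2 * j%:R + 1) * wal F j ^+ 2)
  (wal_upper : forall j, P * j%:R * wal F j ^+ 2 <= 1).
Hypotheses (N8 : (8 <= N)%N) (beta0 : 0 < beta) (betaE : beta ^+ 2 * P * N%:R = 4).

(** [w] stands for the Wallis ratio divided by [beta], [n] for [N] and [y] for the index: the Wallis
    bounds squeeze [w ^+ 2] between [n / (4 * y + 2)] and [n / (4 * y)], both near 1. *)
Lemma ratio_close (w y n d : F) : 0 < n -> 0 < d -> d <= 1 / 4 -> 2 <= d * n -> 0 <= w ->
    `|n - 4 * y| < d * n + 2 -> n <= (4 * y + 2) * w ^+ 2 -> 4 * y * w ^+ 2 <= n ->
  `|w - 1| <= 4 * d.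
Proof.
move=> n0 d0 d4 dn w0; rewrite ltr_norml => /andP[h1 h2] lo hi.
rewrite ler_norml; apply/andP; split.
  rewrite leNgt; apply/negP => w_lt.
  have w2 : w ^+ 2 <= w by rewrite expr2 ler_piMl //; lra.
  have hy : 4 * y + 2 <= (1 + 3 * d) * n by nra.
  have y0 : 0 <= (1 + 3 * d) * n by nra.
  have s1 : n <= (1 + 3 * d) * n * w ^+ 2 by apply: le_trans lo _; rewrite ler_wpM2r ?sqr_ge0.
  have s2 : (1 + 3 * d) * n * w ^+ 2 <= (1 + 3 * d) * n * (1 - 4 * d).
    by apply: ler_wpM2l => //; lra.
  have : n * (d + 12 * d ^+ 2) <= 0 by move: (le_trans s1 s2); lra.
  by rewrite leNgt mulr_gt0 // addr_gt0 // mulr_gt0 // exprn_gt0.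
rewrite leNgt; apply/negP => w_gt.
have hy : (1 - 2 * d) * n <= 4 * y by lra.
have y0 : 0 <= (1 - 2 * d) * n by nra.
have s1 : (1 - 2 * d) * n * w ^+ 2 <= n by apply: le_trans hi; rewrite ler_wpM2r ?sqr_ge0.
have w2' : 1 + 4 * d < w ^+ 2.
  by rewrite expr2; apply: lt_le_trans (_ : w <= _); [lra|rewrite ler_peMl //; lra].
have s2 : (1 - 2 * d) * n * (1 + 4 * d) < (1 - 2 * d) * n * w ^+ 2.
  by rewrite ltr_pM2l // mulr_gt0 //; lra.
have : n * (2 * d * (1 - 4 * d)) < 0 by move: (lt_le_trans s2 s1); lra.
by rewrite ltNge; apply/negP; rewrite negbK mulr_ge0 ?(ltW n0) // mulr_ge0 //; lra.
Qed.

Let N0 : 0 < N%:R :> F. Proof. by rewrite ltr0n; lia. Qed.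
Let P0 : 0 < P. Proof. exact: lt_le_trans P2. Qed.

Lemma wal_close (d : F) j : 0 < d -> d <= 1 / 4 -> 2 <= d * N%:R ->
  `|N%:R - 4 * j%:R| < d * N%:R + 2 -> `|wal F j - beta| <= 4 * d * beta.
Proof.
move=> d0 d4 dN jN; set w := wal F j; set y : F := j%:R.
have b0 : beta != 0 by rewrite gt_eqF.
have E : w = (w / beta) * beta by rewrite divfK.
have -> : w - beta = (w / beta - 1) * beta by rewrite mulrBl mul1r -E.
rewrite normrM (gtr0_norm beta0) ler_wpM2r ?(ltW beta0) //.
have PE : P * N%:R * w ^+ 2 = 4 * (w / beta) ^+ 2.
  have -> : w ^+ 2 = (w / beta) ^+ 2 * beta ^+ 2 by rewrite -exprMn -E.
  by rewrite -betaE; move: (w / beta) => x; ring.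
have x0 : 0 <= w / beta by rewrite divr_ge0 ?(ltW beta0) ?(ltW (wal_gt0 _ _)).
have hl : 2 * N%:R <= (2 * y + 1) * (4 * (w / beta) ^+ 2).
  rewrite -PE; have := ler_wpM2r (ltW N0) (wal_lower j); rewrite -/w -/y.
  by have -> : P * (2 * y + 1) * w ^+ 2 * N%:R = (2 * y + 1) * (P * N%:R * w ^+ 2) by ring.
have hu : y * (4 * (w / beta) ^+ 2) <= N%:R.
  rewrite -PE -[leRHS]mul1r; have := ler_wpM2r (ltW N0) (wal_upper j); rewrite -/w -/y.
  by have -> : P * y * w ^+ 2 * N%:R = y * (P * N%:R * w ^+ 2) by ring.
apply: (@ratio_close _ y N%:R) => //.
  by move: hl; move: (w / beta) (y) => x z; lra.
by move: hu; move: (w / beta) (y) => x z; lra.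
Qed.

Lemma wal_le_2beta j : (N <= 8 * j + 4)%N -> wal F j <= 2 * beta.
Proof.
move=> Nj; have w0 := wal_gt0 F j.
have Nj' : N%:R <= 16 * j%:R :> F by rewrite -natrM ler_nat; lia.
have hu := wal_upper j.
rewrite -(ler_pXn2r (n := 2)) ?nnegrE ?(ltW w0) ?mulr_ge0 ?(ltW beta0) // [(2 * beta) ^+ 2]exprMn.
have PN : 0 < P * N%:R by rewrite mulr_gt0.
rewrite -(ler_pM2r PN).
have -> : 2 ^+ 2 * beta ^+ 2 * (P * N%:R) = 2 ^+ 2 * (beta ^+ 2 * P * N%:R) by ring.
rewrite betaE.
have s : wal F j ^+ 2 * (P * N%:R) <= wal F j ^+ 2 * (P * (16 * j%:R)).
  by rewrite ler_wpM2l ?sqr_ge0 // ler_wpM2l // ltW.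
by apply: le_trans s _; move: hu; move: (wal F j) (j%:R) => x y; lra.
Qed.

Lemma invN_le : 1 / N%:R <= beta ^+ 2.
Proof.
rewrite ler_pdivrMr // -(ler_pM2l P0).
by rewrite mulr1; apply: le_trans P4 _; rewrite -betaE; lra.
Qed.

Lemma beta_le1 : beta <= 1.
Proof.
rewrite -(ler_pXn2r (n := 2)) ?nnegrE ?(ltW beta0) // expr1n.
have N8' : 8 <= N%:R :> F by rewrite (ler_nat _ 8).
have PN : 4 <= P * N%:R by apply: le_trans (ler_pM _ _ P2 N8'); rewrite ?ler0n //; lra.
have := ler_wpM2l (sqr_ge0 beta) PN; rewrite mulrA betaE.
by move: (beta ^+ 2) => x; lra.
Qed.

Lemma q1_le : 4 / N%:R + 2 * beta <= 6 * beta.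
Proof.
have := invN_le; have := beta_le1; have h := beta0.
by rewrite div1r expr2 => b1 h2; nra.
Qed.

Lemma q2_le : 4 / N%:R + 2 * beta * (4 / N%:R + 2 * beta) <= 16 * beta ^+ 2.
Proof.
have h1 := invN_le; have h2 := ler_wpM2l (ltW (mulr_gt0 (ltr0n _ 2) beta0)) q1_le.
by rewrite div1r in h1; rewrite /= in h2; lra.
Qed.

Variables (V : finType) (k : nat) (A S0 : {set V}).
Hypotheses (S0k : #|S0| = k) (k_gt0 : (0 < k)%N) (AS0 : [disjoint A & S0]).
Hypothesis NE : N = 'C(#|V| - 2, k).

Local Notation Z := (coincidences k A).
(** Stein error relative to lam. [d] is the relative deviation allowed for the mixed count: [4 * d]
    is the resulting error of the Wallis ratio and [beta / d ^+ 2] the Chebyshev loss at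
    [a = d * N]. The constant 44 = 2 (16 + 6) collects the triple bound [16 * beta ^+ 2] and the
    pair bound [6 * beta]. *)
Definition rate (d : F) := 44 * #|A|%:R * beta + 4 * d + beta / d ^+ 2.

Lemma stein_rate (f : nat -> F) (d : F) : (forall m, 0 <= f m <= 1) ->
    0 < d -> d <= 1 / 4 -> 2 <= d * N%:R ->
  `|Ex (fun H => (Z H)%:R * f (Z H)) - #|pairs A|%:R * (beta / 2) * Ex (fun H => f (Z H).+1)|
    <= #|pairs A|%:R * (beta / 2) * rate d.
Proof.
move=> f01 d0 d4 dN; have b0 := ltW beta0.
have dN0 : 0 < d * N%:R by rewrite mulr_gt0.
have b01 : 0 <= beta <= 1 by rewrite b0 beta_le1.
have e0 : 0 <= 4 * d * beta by rewrite !mulr_ge0 // ltW.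
have wb j : ('C(#|V| - 2, k) <= 8 * j + 4)%N -> wal F j <= 2 * beta by rewrite -NE; apply: wal_le_2beta.
have wc j : `|'C(#|V| - 2, k)%:R - 4 * j%:R| < d * N%:R + 2 -> `|wal F j - beta| <= 4 * d * beta.
  by rewrite -NE; apply: wal_close.
have N_gt0 : (0 < 'C(#|V| - 2, k))%N by rewrite -NE; lia.
apply: le_trans (stein N_gt0 (mulr_ge0 (ler0n _ 2) b0) wb S0k k_gt0 AS0 f01 b01 dN0 e0 wc) _.
rewrite -[leRHS]mulrA; apply: ler_wpM2l; first by rewrite ler0n.
rewrite -NE /rate.
have h1 : #|A|%:R * (4 / N%:R + 2 * beta * (4 / N%:R + 2 * beta)) <= #|A|%:R * (16 * beta ^+ 2).
  exact: (ler_wpM2l (ler0n F #|A|) q2_le).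
have h2 : beta * #|A|%:R * (4 / N%:R + 2 * beta) <= beta * #|A|%:R * (6 * beta).
  exact: (ler_wpM2l (mulr_ge0 b0 (ler0n F #|A|)) q1_le).
have h3 : N%:R / (d * N%:R) ^+ 2 <= beta ^+ 2 / d ^+ 2.
  have -> : N%:R / (d * N%:R) ^+ 2 = (1 / N%:R) / d ^+ 2 by field; rewrite !gt_eqF.
  by rewrite ler_wpM2r ?invr_ge0 ?exprn_ge0 ?(ltW d0) // invN_le.
have -> : beta / 2 * (44 * #|A|%:R * beta + 4 * d + beta / d ^+ 2) =
  #|A|%:R * (16 * beta ^+ 2) + (4 * d * beta + beta ^+ 2 / d ^+ 2) / 2 + beta * #|A|%:R * (6 * beta).
  by field; rewrite gt_eqF.
by apply: lerD h2; apply: lerD h1 _; rewrite ler_wpM2r ?invr_ge0 // lerD2l.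
Qed.

(** With the indicator of 1 as test function, the two expectations in Stein's identity are Pr(Z =
    1), which is at most 1, and Pr(Z = 0). *)
Lemma Pr_coincidences0_lam (d : F) : 0 < d -> d <= 1 / 4 -> 2 <= d * N%:R ->
  #|pairs A|%:R * (beta / 2) * Pr F (fun H => Z H == 0%N) <= 1 + #|pairs A|%:R * (beta / 2) * rate d.
Proof.
move=> d0 d4 dN; have f01 m : 0 <= ((m == 1%N)%:R : F) <= 1 by rewrite ler0n lern1 leq_b1.
have := stein_rate f01 d0 d4 dN.
have -> : Ex (fun H => (Z H)%:R * (Z H == 1%N)%:R) = Pr F (fun H => Z H == 1%N).
  by apply: eq_Ex => H; case: eqP => [->|]; rewrite ?mulr1 ?mulr0.
have -> : Ex (fun H => ((Z H).+1 == 1%N)%:R) = Pr F (fun H => Z H == 0%N) by apply: eq_Ex => H.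
have := Pr_le1 F (card_set_gt0 {set V}) (fun H => Z H == 1%N).
by rewrite ler_norml => h /andP[h1 h2]; lra.
Qed.

Lemma Pr_coincidences0_stein (f : nat -> F) (e d : F) : (forall m, 0 <= f m <= 1) ->
    (forall m, #|pairs A|%:R * (beta / 2) * f m.+1 - m%:R * f m = (m == 0%N)%:R - e) ->
    0 < d -> d <= 1 / 4 -> 2 <= d * N%:R ->
  `|Pr F (fun H => Z H == 0%N) - e| <= #|pairs A|%:R * (beta / 2) * rate d.
Proof.
move=> f01 fE d0 d4 dN; have := stein_rate f01 d0 d4 dN.
rewrite -ExZ -ExB.
rewrite (eq_Ex (g := fun H => e - (Z H == 0%N)%:R)) => [|H].
  by rewrite ExB Ex_cst ?card_set_gt0 // distrC.
by rewrite -opprB fE opprB.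
Qed.

End WallisConsequences.

(** * Asymptotic statements and convergence *)

Section Eventually.

Definition ev (P : nat -> Prop) := exists n0 : nat, forall n, (n0 <= n)%N -> P n.

Lemma ev_and P Q : ev P -> ev Q -> ev (fun n => P n /\ Q n).
Proof.
move=> [p hp] [q hq]; exists (maxn p q) => n; rewrite geq_max => /andP[pn qn].
by split; [apply: hp|apply: hq].
Qed.

Lemma ev_imp (P Q : nat -> Prop) : (forall n, P n -> Q n) -> ev P -> ev Q.
Proof. by move=> PQ [p hp]; exists p => n /hp/PQ. Qed.

Lemma ev_ge n0 : ev (fun n => (n0 <= n)%N).
Proof. by exists n0. Qed.

(* One-sided, since it is only applied to upper bounds of nonnegative quantities. *)
Definition small (u : nat -> R) := forall eps : R, 0 < eps -> ev (fun n => u n <= eps).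

Lemma small_le u v : ev (fun n => u n <= v n) -> small v -> small u.
Proof.
move=> uv sv eps e0; apply: ev_imp (ev_and uv (sv eps e0)) => n [h1 h2].
exact: le_trans h2.
Qed.

Lemma smallD u v : small u -> small v -> small (fun n => u n + v n).
Proof.
move=> su sv eps e0; have e2 : 0 < eps / 2 by rewrite divr_gt0.
by apply: ev_imp (ev_and (su _ e2) (sv _ e2)) => n [h1 h2]; lra.
Qed.

Lemma smallZ (c : R) u : 0 <= c -> small u -> small (fun n => c * u n).
Proof.
move=> c0 su eps e0; have c1 : 0 < c + 1 by lra.
apply: ev_imp (su (eps / (c + 1)) _) => [n|]; last by rewrite divr_gt0.
rewrite ler_pdivlMr // => h.
have [un|un] := leP 0 (u n); first by apply: le_trans h; lra.
by apply: le_trans (_ : 0 <= _); [rewrite mulr_ge0_le0 // ltW|rewrite ltW].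
Qed.

Lemma ev_natr_ge (c : R) : ev (fun n => c <= n%:R).
Proof.
exists (Num.bound `|c|) => n hn; apply: le_trans (ler_norm c) _.
by apply: ltW; apply: lt_le_trans (archi_boundP (normr_ge0 c)) _; rewrite ler_nat.
Qed.

Lemma small_div (C : R) u : ev (fun n => u n * n%:R <= C) -> small u.
Proof.
move=> uC eps e0.
apply: ev_imp (ev_and uC (ev_and (ev_natr_ge (C / eps)) (ev_ge 1))) => n [h1 [h2 n1]].
have n0 : 0 < n%:R :> R by rewrite ltr0n.
rewrite -(ler_pM2r n0); apply: le_trans h1 _.
by move: h2; rewrite ler_pdivrMr // mulrC.
Qed.

Lemma small_sq u : small (fun n => u n ^+ 2) -> small u.
Proof.
move=> su eps e0; apply: ev_imp (su (eps ^+ 2) (exprn_gt0 2 e0)) => n h.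
rewrite leNgt; apply/negP => lt; have : eps ^+ 2 < u n ^+ 2 by rewrite ltrXn2r // ?nnegrE ?(ltW e0) // ltW // (lt_trans e0).
by rewrite ltNge h.
Qed.

Lemma Un_cv_small (u v : nat -> R) l : ev (fun n => `|u n - l| <= v n) -> small v -> Un_cv u l.
Proof.
move=> uv sv eps /RltP e0; have e2 : 0 < eps / 2 by rewrite divr_gt0.
have [n0 h] := ev_and uv (sv _ e2); exists n0 => n /ssrnat.leP /h [h1 h2].
rewrite /Rfunctions.R_dist RabsE RminusE; apply/RltP.
by apply: le_lt_trans h1 _; apply: le_lt_trans h2 _; rewrite ltr_pdivrMr // ltr_pMr // ltr1n.
Qed.

End Eventually.

(** * Polynomial bounds on binomial coefficients *)

Section BinomialBounds.

Lemma bin_lower m k : ((m - k) ^ k <= 'C(m, k) * k`!)%N.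
Proof.
rewrite bin_ffact ffact_prod -[X in (_ ^ X)%N]card_ord -prod_nat_const.
by apply: leq_prod => i _; have := ltn_ord i; lia.
Qed.

Lemma bin_upper m k : ('C(m, k) <= m ^ k)%N.
Proof.
have : ('C(m, k) * k`! <= m ^ k)%N.
  rewrite bin_ffact ffact_prod -[X in (_ ^ X)%N]card_ord -prod_nat_const.
  by apply: leq_prod => i _; lia.
by apply: leq_trans; rewrite leq_pmulr // fact_gt0.
Qed.

Lemma bin2_lower k : ev (fun n => n ^ k <= 2 ^ k * k`! * 'C(n - 2, k))%N.
Proof.
exists (2 * k + 4)%N => n hn.
apply: (@leq_trans ((2 * (n - 2 - k)) ^ k)%N).
  by case: k hn => // k hn; rewrite leq_exp2r //; lia.
by rewrite expnMn -mulnA leq_mul2l mulnC bin_lower orbT.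
Qed.

Lemma bin4_lower k : ev (fun n => n ^ k <= 4 ^ k * k`! * 'C((n %/ 4).*2, k))%N.
Proof.
exists (4 * k + 16)%N => n hn.
apply: (@leq_trans ((4 * ((n %/ 4).*2 - k)) ^ k)%N).
  case: k hn => // k hn; rewrite leq_exp2r //; have := divn_eq n 4; have := ltn_pmod n (isT : 0 < 4)%N; lia.
by rewrite expnMn -mulnA leq_mul2l mulnC bin_lower orbT.
Qed.

Lemma cube_le_exp2 m : (m ^ 3 <= 8 * 2 ^ m)%N.
Proof.
case: m => [|[|[|[|m]]]] //; elim: m => // m IHm.
rewrite [(2 ^ _)%N]expnS mulnCA; apply: leq_trans (_ : 2 * m.+4 ^ 3 <= _)%N; last by rewrite leq_mul2l IHm orbT.
rewrite !expnS !expn0 !muln1; nia.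
Qed.

Lemma card_pairs (V : finType) (A : {set V}) : (2 * #|pairs A| + #|A| = #|A| * #|A|)%N.
Proof.
have sumE (r : V -> V -> bool) : (\sum_(x in A) \sum_(y in A) r x y = #|[set p : V * V | [&& p.1 \in A, p.2 \in A & r p.1 p.2]]|)%N.
  rewrite pair_big /= -sum1_card big_mkcond [RHS]big_mkcond; apply: eq_bigr => -[x y] _ /=.
  by rewrite inE /=; case: (x \in A) (y \in A) (r x y) => [] [] [].
have E1 : (\sum_(x in A) \sum_(y in A) (enum_rank x < enum_rank y)%N = #|pairs A|)%N := sumE _.
have E2 : (\sum_(x in A) \sum_(y in A) (enum_rank y < enum_rank x)%N = #|pairs A|)%N by rewrite exchange_big.
have E3 : (\sum_(x in A) \sum_(y in A) (x == y) = #|A|)%N.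
  rewrite -sum1_card; apply: eq_bigr => x xA; rewrite (bigD1 x) //= eqxx big1 // => y /andP[_].
  by rewrite eq_sym => /negPf->.
have E4 : (\sum_(x in A) \sum_(y in A) 1 = #|A| * #|A|)%N by rewrite !sum_nat_const muln1.
rewrite -[RHS]E4 mul2n -addnn -{1}E1 -{1}E2 -{1}E3 -!big_split; apply: eq_bigr => x _.
rewrite -!big_split; apply: eq_bigr => y _ /=.
have := neq_rank x y; case: eqVneq => [->|_]; first by rewrite ltnn.
by case: ltngtP.
Qed.

End BinomialBounds.
Local Bind Scope ring_scope with R.

Lemma PI_ge2 : 2 <= PI :> R.
Proof. by apply/RleP; rewrite -INRE /=; have := PI2_1; Lra.lra. Qed.

Lemma PI_le4 : PI <= 4 :> R.
Proof. by apply/RleP; rewrite -INRE /=; have := PI_4; Lra.lra. Qed.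

Lemma probE k (P : forall n, {set {set 'I_n}} -> bool) n :
  prob k.+1 P n = Pr R (fun H => P n (H :&: layer n k)).
Proof.
have powE m : Nat.pow 2 m = expn 2 m by elim: m => // m IHm; rewrite expnS -IHm /=; lia.
by rewrite -Pr_uniform /prob powE !INRE RdivE natrX.
Qed.

(** * Orders of magnitude of beta and lam *)

Section Rates.

Variable k : nat.

(** The asymptotic value 1 / sqrt(pi j) of the Wallis ratio at j = N/4, half of the typical number
    N/2 of mixed links. *)
Definition beta n : R := 2 / Num.sqrt (PI * 'C(n - 2, k)%:R).

Lemma beta_spec n : (0 < 'C(n - 2, k))%N ->
  0 < beta n /\ beta n ^+ 2 * PI * 'C(n - 2, k)%:R = 4.
Proof.
move=> N0; have p : 0 < PI * 'C(n - 2, k)%:R :> R by rewrite mulr_gt0 ?PI_gt0 // ltr0n.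
split; first by rewrite /beta; apply: divr_gt0; [exact: (ltr0n _ 2)|rewrite sqrtr_gt0].
rewrite -mulrA /beta expr_div_n sqr_sqrtr ?(ltW p) // divfK ?gt_eqF //.
by rewrite -natrX.
Qed.

Hypothesis k_gt0 : (0 < k)%N.

Lemma ev_N M : ev (fun n => M <= 'C(n - 2, k))%N.
Proof.
apply: ev_imp (ev_and (bin2_lower k) (ev_ge (2 ^ k * k`! * M).+1)) => n [h1 h2].
rewrite leqNgt; apply/negP => NM.
have : (n <= n ^ k)%N by rewrite -{1}[n]expn1 leq_pexp2l //; lia.
have := leq_mul (leqnn (2 ^ k * k`!)%N) (ltnW NM); lia.
Qed.

Lemma ev_dN (d : R) : 0 < d -> ev (fun n => 2 <= d * 'C(n - 2, k)%:R).
Proof.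
move=> d0; have [n1 h1] := ev_natr_ge (2 / d).
apply: ev_imp (ev_N n1) => n /h1.
by rewrite ler_pdivrMr // mulrC.
Qed.

Lemma betaN_le n : (0 < 'C(n - 2, k))%N -> beta n ^+ 2 * 'C(n - 2, k)%:R <= 2.
Proof.
move=> N0; have [b0 bE] := beta_spec N0; have p2 := PI_ge2.
have x0 : 0 <= beta n ^+ 2 * 'C(n - 2, k)%:R by rewrite mulr_ge0 ?sqr_ge0.
have := ler_wpM2r x0 p2.
have -> : PI * (beta n ^+ 2 * 'C(n - 2, k)%:R) = 4 by rewrite -bE; ring.
by move: (beta n ^+ 2 * _) => x; lra.
Qed.

Lemma ev_nkbeta : ev (fun n => n%:R ^+ k * beta n ^+ 2 <= 2 * (2 ^ k * k`!)%:R).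
Proof.
apply: ev_imp (ev_and (bin2_lower k) (ev_N 1)) => n [h1 N0].
have := betaN_le N0; set b := beta n ^+ 2 => hb.
have b0 : 0 <= b by rewrite sqr_ge0.
have : n%:R ^+ k <= (2 ^ k * k`!)%:R * 'C(n - 2, k)%:R :> R by rewrite -natrX -natrM ler_nat.
move=> /(ler_wpM2r b0) h; apply: le_trans h _.
rewrite -mulrA [2 * _]mulrC ler_wpM2l ?ler0n //; move: hb; by rewrite mulrC.
Qed.

Lemma beta_lower n : (0 < 'C(n - 2, k))%N -> 1 <= beta n ^+ 2 * n%:R ^+ k.
Proof.
move=> N0; have [b0 bE] := beta_spec N0.
have h1 : 'C(n - 2, k)%:R <= n%:R ^+ k :> R.
  rewrite -natrX ler_nat; apply: leq_trans (bin_upper _ _) _.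
  by rewrite leq_exp2r // leq_subr.
have h2 : PI * 'C(n - 2, k)%:R <= 4 * n%:R ^+ k :> R.
  by apply: ler_pM h1; rewrite ?ler0n ?PI_le4 // ltW // PI_gt0.
have := ler_wpM2l (sqr_ge0 (beta n)) h2; rewrite mulrA bE.
by move: (beta n ^+ 2) (n%:R ^+ k) => x y; lra.
Qed.

Lemma small_nbeta a : (2 * a + 1 <= k)%N -> small (fun n => n%:R ^+ a * beta n).
Proof.
move=> ak; apply: small_sq; apply: (@small_div (2 * (2 ^ k * k`!)%:R)).
apply: ev_imp (ev_and ev_nkbeta (ev_ge 1)) => n [h n1].
rewrite exprMn -exprM mulrAC -exprSr; apply: le_trans h.
by rewrite ler_wpM2r ?sqr_ge0 // -!natrX ler_nat leq_pexp2l //; lia.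
Qed.

Lemma small_beta : small beta.
Proof.
apply: small_le (small_nbeta (a := 0) _); last lia.
by exists 0%N => n _; rewrite expr0 mul1r.
Qed.

(** [d] is fixed first, from [eps] alone; the terms with [beta] then vanish as [n] grows, however
    large [1 / d ^+ 2] is. *)
Lemma small_rate (m : nat -> nat) : small (fun n => (m n)%:R * beta n) ->
  forall eps : R, 0 < eps -> exists d : R, [/\ 0 < d, d <= 1 / 4 &
    ev (fun n => 44 * (m n)%:R * beta n + 4 * d + beta n / d ^+ 2 <= eps)].
Proof.
move=> sm eps e0; pose d : R := Num.min (1 / 4) (eps / 16).
have d0 : 0 < d by rewrite lt_min !divr_gt0.
have d4 : d <= 1 / 4 by rewrite ge_min lexx.
have d16 : d <= eps / 16 by rewrite ge_min lexx orbT.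
exists d; split=> //.
have e2 : 0 < eps / 2 by rewrite divr_gt0.
have i0 : 0 <= (d ^+ 2)^-1 by rewrite invr_ge0 exprn_ge0 // ltW.
apply: ev_imp (smallD (smallZ (ler0n _ 44) sm) (smallZ i0 small_beta) e2) => n.
by rewrite -mulrA [beta n / _]mulrC => h; lra.
Qed.

Lemma Pr_pair_le n (x y : 'I_n) : (8 <= 'C(n - 2, k))%N -> (3 <= n)%N -> x != y ->
  Pr R (fun H => deg k H x == deg k H y) <= 6 * beta n.
Proof.
move=> N8 n3 xy; have N0 : (0 < 'C(n - 2, k))%N by lia.
have [b0 bE] := beta_spec N0.
have /card_gt0P[z] : (0 < #|~: [set x; y]|)%N.
  by have := cardsC [set x; y]; rewrite cards2 xy card_ord; lia.
rewrite !inE negb_or => /andP[zx zy].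
apply: le_trans (q1_le PI_ge2 PI_le4 N8 b0 bE).
have hw j : ('C(#|'I_n| - 2, k) <= 8 * j + 4)%N -> wal R j <= 2 * beta n.
  by rewrite card_ord; exact: (wal_le_2beta PI_ge2 PI_le4 wallis_upper N8 b0 bE).
have N0' : (0 < 'C(#|'I_n| - 2, k))%N by rewrite card_ord.
have := Pr_deg_eq2 N0' (mulr_ge0 (ler0n _ 2) (ltW b0)) hw xy zx zy.
by rewrite card_ord.
Qed.

Lemma exists_subset (T : finType) (B : {set T}) j : (j <= #|B|)%N ->
  exists2 A : {set T}, (A \subset B) & #|A| = j.
Proof.
rewrite -bin_gt0 -cards_draws => /card_gt0P[A]; rewrite inE => /andP[AB /eqP Aj].
by exists A.
Qed.

Lemma exists_disjoint n m : (m + k <= n)%N ->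
  exists S0 A : {set 'I_n}, [/\ #|S0| = k, #|A| = m & [disjoint A & S0]].
Proof.
move=> mk; have [|S0 _ S0k] := @exists_subset _ [set: 'I_n] k; first by rewrite cardsT card_ord; lia.
have [|A AS0 Am] := @exists_subset _ (~: S0) m.
  by have := cardsC S0; rewrite card_ord S0k; lia.
by exists S0, A; split; rewrite // disjoints_subset.
Qed.

Definition lam n (m : nat) : R := m%:R * (m%:R - 1) / 4 * beta n.

Lemma pairs_lam n (A : {set 'I_n}) : #|pairs A|%:R * (beta n / 2) = lam n #|A|.
Proof.
have : 2 * #|pairs A|%:R + #|A|%:R = #|A|%:R * #|A|%:R :> R by rewrite -!natrM -natrD card_pairs.
rewrite /lam; move: (#|A|%:R) (#|pairs A|%:R) (beta n) => x y z E.
have -> : y = (x * x - x) / 2 by rewrite -E; field.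
by field.
Qed.

End Rates.

(** * Two error events: no common edge, and failure of two weights *)

Section CommonEdges.

Variable k : nat.
Hypothesis k_gt1 : (2 <= k)%N.

(** As [k >= 2], the exponent grows at least linearly in [n]; the cube of [n] is then bounded by a
    constant times the power of 2, which leaves a factor 1/n after the n^2 pairs. *)
Lemma small_common : small (fun n => n%:R ^+ 2 * (1 / 2 ^+ 'C(n - 2, k.-1))).
Proof.
set c := (2 ^ k.-1 * k.-1`!)%N.
apply: (@small_div (8 * c ^ 3)%:R).
apply: ev_imp (ev_and (bin2_lower k.-1) (ev_ge 1)) => n [h n1].
rewrite mulrAC -exprSr mulrA mulr1 ler_pdivrMr ?exprn_gt0 // -!natrX -natrM ler_nat.
set M := 'C(n - 2, k.-1) in h *.
have nM : (n <= c * M)%N.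
  by apply: leq_trans h; rewrite -{1}[n]expn1 leq_pexp2l //; lia.
apply: (@leq_trans ((c * M) ^ 3)%N); first by rewrite leq_exp2r.
by rewrite expnMn [(8 * _)%N]mulnC -mulnA leq_mul2l cube_le_exp2 orbT.
Qed.

(** Candidate links are at least quadratically many, again by [k >= 2]: more than the linear demand
    of the greedy choice, and enough for a union bound of order 1/n. *)
Lemma small_nsw2 : small (fun n => Pr R (fun H => ~~ strongly_weighted 2 (H :&: layer n k))).
Proof.
set c := (4 ^ k * k`!)%N; pose K n := 'C((n %/ 4).*2, k).
have hK : ev (fun n => (0 < n)%N /\ (n * n <= c * K n)%N).
  apply: ev_imp (ev_and (bin4_lower k) (ev_ge 1)) => n [h n1]; split=> //.
  by apply: leq_trans h; rewrite mulnn leq_pexp2l.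
apply: (@small_le _ (fun n => n%:R * (48 / (K n)%:R))); last first.
  apply: (@small_div (48 * c%:R)); apply: ev_imp hK => n [n0 h].
  have K0 : (0 < K n)%N by move: h; case: (K n) => //; rewrite muln0 leqn0 muln_eq0 orbb; lia.
  rewrite [X in X <= _](_ : _ = 48 * (n%:R * n%:R) / (K n)%:R); last by ring.
  rewrite ler_pdivrMr ?ltr0n // -[leRHS]mulrA ler_wpM2l //.
  by rewrite -!natrM ler_nat.
apply: ev_imp (ev_and hK (ev_ge (32 * c).+1)) => n [[n0 h] n32].
case: n n0 h n32 => // n _ h n32.
apply: (@Pr_nsw2_le R n k (K n.+1)) => //.
have c0 : (0 < c)%N by rewrite /c muln_gt0 expn_gt0 fact_gt0.
rewrite -(leq_pmul2l c0); apply: leq_trans h; rewrite mulnA leq_mul2r mulnC; lia.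
Qed.

End CommonEdges.

Local Notation Pr_sw1 k n := (Pr R (fun H => sw1 (H :&: layer n k))).

(** * Uniformities 3 and 4: one weight almost never suffices *)

Section Vanishing.

Lemma ler_inv_rate (L l p r : R) : 0 < L -> L <= l -> l * p <= 1 + l * r -> p <= 1 / L + r.
Proof.
move=> L0 Ll h; have l0 := lt_le_trans L0 Ll.
rewrite -lerBlDr ler_pdivlMr //.
have [pr|pr] := leP (p - r) 0; first by apply: le_trans (_ : 0 <= _); rewrite ?mulr_le0_ge0 // ltW.
apply: le_trans (_ : (p - r) * l <= _); first by rewrite ler_wpM2l // ltW.
by rewrite mulrBl [p * l]mulrC [r * l]mulrC; lra.
Qed.

Lemma Pr_sw1_vanish k (m : nat -> nat) (L : R) : (2 <= k)%N -> 0 < L ->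
    ev (fun n => m n + k <= n)%N -> small (fun n => (m n)%:R * beta k n) ->
    ev (fun n => L <= lam k n (m n)) ->
  forall eps : R, 0 < eps -> ev (fun n => Pr_sw1 k n <= 1 / L + eps).
Proof.
move=> k2 L0 hm sm hL eps e0; have k0 : (0 < k)%N by lia.
have e2 : 0 < eps / 2 by rewrite divr_gt0.
have [d [d0 d4 hd]] := small_rate k0 sm e2.
apply: ev_imp (ev_and hm (ev_and hL (ev_and hd (ev_and (ev_N k0 8)
  (ev_and (ev_dN k0 d0) (small_common k2 e2)))))) => n [mk [Ll [hr [N8 [dN hc]]]]].
have [S0 [A [S0k Am AS0]]] := exists_disjoint k0 mk.
have [b0 bE] : 0 < beta k n /\ _ := beta_spec (ltn_trans (isT : 0 < 7)%N N8).
have NE : 'C(n - 2, k) = 'C(#|'I_n| - 2, k) by rewrite card_ord.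
have := Pr_coincidences0_lam PI_ge2 PI_le4 wallis_lower wallis_upper N8 b0 bE S0k k0 AS0 NE d0 d4 dN.
rewrite pairs_lam Am /rate Am => /(ler_inv_rate L0 Ll) h.
apply: le_trans (Pr_sw1_le R A k0) _.
by apply: le_trans (lerD h hc) _; lra.
Qed.

(** With [m = |A|] about sqrt(L n), [m (m - 1) >= L n / 2] and [beta * n >= 1] give lam at least
    L/8, while [m * beta] is of order n^(-1/2). *)
Lemma vanish_sw1_3 : small (fun n => Pr_sw1 2 n).
Proof.
move=> eps e0; pose L := (Num.bound (16 / eps)).+1.
have L0 : 0 < L%:R / 8 :> R by rewrite divr_gt0 // ltr0n.
have hL : 1 / (L%:R / 8) <= eps / 2 :> R.
  rewrite div1r invf_div ler_pdivrMr ?ltr0n // mulrAC ler_pdivlMr //.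
  have : 16 / eps < L%:R.
    apply: lt_trans (archi_boundP _) _; first by rewrite divr_ge0 // ltW.
    by rewrite ltr_nat.
  by rewrite ltr_pdivrMr // => h; lra.
pose m n := Nat.sqrt (L * n).
have m_le n : (m n * m n <= L * n)%N by have := proj1 (PeanoNat.Nat.sqrt_spec (L * n) (PeanoNat.Nat.le_0_l _)); rewrite /m; lia.
have m_gt n : (L * n < (m n).+1 * (m n).+1)%N by have := proj2 (PeanoNat.Nat.sqrt_spec (L * n) (PeanoNat.Nat.le_0_l _)); rewrite /m; lia.
have e2 : 0 < eps / 2 by rewrite divr_gt0.
have hm : ev (fun n => m n + 2 <= n)%N.
  by apply: ev_imp (ev_ge (L + 4)) => n hn; have := m_le n; nia.
have sm : small (fun n => (m n)%:R * beta 2 n).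
  apply: small_sq; apply: (@small_div (L%:R * (2 * (2 ^ 2 * 2`!)%:R))).
  apply: ev_imp (ev_nkbeta (isT : 0 < 2)%N) => n h.
  apply: le_trans (ler_wpM2l (ler0n R L) h).
  rewrite [leRHS]mulrA [leLHS](_ : _ = (m n)%:R ^+ 2 * n%:R * beta 2 n ^+ 2); last by ring.
  by rewrite ler_wpM2r ?sqr_ge0 // -!natrX -!natrM ler_nat -!mulnn mulnA leq_mul2r m_le orbT.
have hlam : ev (fun n => L%:R / 8 <= lam 2 n (m n)).
  apply: ev_imp (ev_and (ev_ge 49) (ev_N (isT : 0 < 2)%N 1)) => n [n49 N0].
  have [b0 _] := beta_spec N0.
  have bn : 1 <= beta 2 n * n%:R.
    have bn0 : 0 <= beta 2 n * n%:R by rewrite mulr_ge0 ?ler0n // ltW.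
    have := beta_lower (isT : 0 < 2)%N N0; rewrite -exprMn => h; rewrite leNgt; apply/negP => lt.
    by move: h; rewrite leNgt expr_lt1 // lt.
  have h : (L * n <= 2 * (m n * (m n).-1))%N by have := m_gt n; rewrite /L; nia.
  have m0 : (0 < m n)%N by have := m_gt n; rewrite /L; case: (m n) => //; lia.
  have {}h : L%:R * n%:R <= 2 * ((m n)%:R * ((m n)%:R - 1)) :> R.
    have -> : (m n)%:R - 1 = (m n).-1%:R :> R by rewrite -subn1 natrB.
    by rewrite -!natrM ler_nat.
  rewrite /lam; have := ler_wpM2r (ltW b0) h; have := ler_wpM2l (ler0n R L) bn.
  by move: (m n)%:R (beta 2 n) (n%:R) (L%:R) => x y z t; lra.
apply: ev_imp (Pr_sw1_vanish (leqnn 2) L0 hm sm hlam e2) => n h.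
by apply: le_trans h _; lra.
Qed.

(** Here [beta] is of order n^(-3/2), so [A] may omit only the three vertices of [S0]; lam grows
    like sqrt(n). *)
Lemma vanish_sw1_4 : small (fun n => Pr_sw1 3 n).
Proof.
move=> eps e0; have e2 : 0 < eps / 2 by rewrite divr_gt0.
have L0 : 0 < 2 / eps by rewrite divr_gt0.
have hm : ev (fun n => (n - 3) + 3 <= n)%N by apply: ev_imp (ev_ge 3) => n hn; lia.
have sm : small (fun n => (n - 3)%:R * beta 3 n).
  apply: small_le (small_nbeta (isT : 0 < 3)%N (isT : 2 * 1 + 1 <= 3)%N).
  apply: ev_imp (ev_N (isT : 0 < 3)%N 1) => n N0; have [b0 _] := beta_spec N0.
  by rewrite expr1 ler_wpM2r ?(ltW b0) // ler_nat leq_subr.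
have hlam : ev (fun n => 2 / eps <= lam 3 n (n - 3)).
  (* 256 is 16 squared: 16 lam = 4 |A| (|A| - 1) beta is at least n^2 beta, whose square is at least
     n. *)
  apply: ev_imp (ev_and (ev_natr_ge (256 * (2 / eps) ^+ 2)) (ev_and (ev_ge 10) (ev_N (isT : 0 < 3)%N 1))).
  move=> n [hn [n10 N0]]; have [b0 _] := beta_spec N0; have bn := beta_lower (isT : 0 < 3)%N N0.
  have h : (n * n <= 4 * ((n - 3) * (n - 4)))%N by nia.
  have {}h : n%:R * n%:R <= 4 * ((n - 3)%:R * ((n - 3)%:R - 1)) :> R.
    have -> : (n - 3)%:R - 1 = (n - 4)%:R :> R by rewrite (_ : (n - 4)%N = (n - 3 - 1)%N) ?[RHS]natrB //; lia.
    by rewrite -!natrM ler_nat.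
  have q0 : 0 <= (n - 3)%:R * ((n - 3)%:R - 1) :> R.
    by rewrite -(pmulr_rge0 _ (ltr0n R 4 : 0 < 4)); apply: le_trans h; rewrite mulr_ge0 ?ler0n.
  have l0 : 0 <= lam 3 n (n - 3) by rewrite /lam mulr_ge0 ?(ltW b0) // divr_ge0.
  rewrite -(ler_pXn2r (n := 2)) ?nnegrE ?(ltW L0) // -(ler_pM2l (_ : 0 < 256)) ?ltr0n //.
  apply: le_trans hn _; rewrite /lam.
  have h2 : (n%:R * n%:R) ^+ 2 <= (4 * ((n - 3)%:R * ((n - 3)%:R - 1))) ^+ 2 :> R.
    rewrite lerXn2r // nnegrE; [by rewrite mulr_ge0 ?ler0n|exact: (mulr_ge0 (ler0n R 4) q0)].
  have h3 := ler_wpM2r (sqr_ge0 (beta 3 n)) h2.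
  have h4 := ler_wpM2l (ler0n R n) bn.
  apply: le_trans (_ : n%:R * (beta 3 n ^+ 2 * n%:R ^+ 3) <= _); first by rewrite mulr1 in h4.
  apply: le_trans (_ : (n%:R * n%:R) ^+ 2 * beta 3 n ^+ 2 <= _).
    by rewrite le_eqVlt; apply/orP; left; apply/eqP; ring.
  apply: le_trans h3 _; rewrite le_eqVlt; apply/orP; left; apply/eqP.
  by move: (n - 3)%:R (beta 3 n) => x b; field.
apply: ev_imp (Pr_sw1_vanish (isT : 2 <= 3)%N L0 hm sm hlam e2) => n h.
by apply: le_trans h _; rewrite div1r invf_div; lra.
Qed.

End Vanishing.

(** * Uniformity 5: the Poisson limit *)

Section Poisson.

Let l : R := sqrt (Rdiv 6 PI).

Lemma sqr_limit_rate : l ^+ 2 * PI = 6.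
Proof.
have p0 := PI_gt0; have q0 : 0 <= 6 / PI :> R by rewrite divr_ge0 ?(ltW p0).
have -> : l = Num.sqrt (6 / PI).
  by rewrite /l -RsqrtE; congr sqrt; rewrite RdivE -INRE /=; congr (_ / _); Lra.lra.
by rewrite sqr_sqrtr // divfK // gt_eqF.
Qed.

Lemma limit_rate_bounds : 1 <= l /\ l <= 2.
Proof.
have E := sqr_limit_rate; have p2 := PI_ge2; have p4 := PI_le4; have p0 := PI_gt0.
have l0 : 0 <= l by apply/RleP; apply: sqrt_pos.
split; rewrite -(ler_pXn2r (n := 2)) ?nnegrE ?ler0n ?ler01 // -(ler_pM2r p0) E; lra.
Qed.

Lemma exp_opp_dist (a b : R) : 0 <= a -> a <= b -> `|exp (- a) - exp (- b)| <= b - a.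
Proof.
move=> a0 ab; have {a0 ab} : Rle (IZR 0) (Rminus (exp (Ropp a)) (exp (Ropp b))) /\
    Rle (Rminus (exp (Ropp a)) (exp (Ropp b))) (Rminus b a).
  move/RleP: a0 => a0; move/RleP: ab => ab; change (Rle (IZR 0) a) in a0.
  have e0 := exp_pos (Ropp a).
  have e1 : Rle (exp (Ropp a)) (IZR 1).
    by case: (Rle_lt_or_eq_dec _ _ a0) => [?|<-]; [rewrite -exp_0; apply: Rlt_le; apply: exp_increasing; Lra.lra|rewrite Ropp_0 exp_0; Lra.lra].
  have eb : exp (Ropp b) = Rmult (exp (Ropp a)) (exp (Rminus a b)) by rewrite -exp_plus; congr exp; Lra.lra.
  have h1 := exp_ineq1_le (Rminus a b).
  have h2 : Rle (exp (Rminus a b)) (IZR 1).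
    by case: (Rle_lt_or_eq_dec _ _ ab) => [?|->]; [rewrite -exp_0; apply: Rlt_le; apply: exp_increasing; Lra.lra|rewrite Rminus_diag exp_0; Lra.lra].
  rewrite eb; Psatz.nra.
move=> [/RleP h1 /RleP h2]; rewrite ger0_norm; [exact: h2|exact: h1].
Qed.

(* Solution of Stein's equation for the indicator of 0. *)
Definition poisson_test (la : R) (m : nat) : R := if m is j.+1 then expI la j else 0.

Lemma poisson_test01 (la : R) m : 0 <= la -> 0 <= poisson_test la m <= 1.
Proof.
move=> /RleP la0; case: m => [|j] /=; first by rewrite lexx ler01.
by have [/RleP h1 /RleP h2] := expI01 j la0; apply/andP; split.
Qed.

Lemma poisson_test_rec (la : R) m :
  la * poisson_test la m.+1 - m%:R * poisson_test la m = (m == 0%N)%:R - exp (- la).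
Proof.
case: m => [|j] /=; first by rewrite mul0r subr0; exact: expI0.
by rewrite sub0r -INRE; exact: expI_rec.
Qed.

(** Here n = m + 6 and |A| = n - 4, a shift that avoids truncated subtraction. The factors m + 2 and
    m + 1 of 24 N cancel against lam squared, and the remaining rational function shows that lam^2
    pi tends to 6. *)
Lemma lam5_sq m : lam 4 m.+4.+2 m.+2 ^+ 2 * PI * ((m%:R + 4) * (m%:R + 3)) = 6 * ((m%:R + 2) * (m%:R + 1)).
Proof.
have N0 : (0 < 'C(m.+4.+2 - 2, 4))%N by rewrite bin_gt0; lia.
have [b0 bE] := beta_spec N0.
have NE : 'C(m.+4.+2 - 2, 4)%:R * 24 = (m%:R + 4) * ((m%:R + 3) * ((m%:R + 2) * (m%:R + 1))) :> R.
  have -> : (m.+4.+2 - 2 = m.+4)%N by lia.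
  rewrite -[24]/((4`!)%:R) -natrM bin_ffact !ffactnS ffactn0 muln1 !natrM.
  by congr (_ * (_ * (_ * _))); rewrite /=; [rewrite -natrD addn4|rewrite -natrD addn3|rewrite -natrD addn2|rewrite natr1].
have z0 : (m%:R + 2) * (m%:R + 1) != 0 :> R by rewrite natr1 -natrD -natrM pnatr_eq0; lia.
apply: (mulIf z0); rewrite /lam.
have -> : m.+2%:R = m%:R + 2 :> R by rewrite -natrD addn2.
move: b0 bE NE z0; move: (beta 4 _) ('C(_, _)%:R) (m%:R) PI => b N x p b0 bE NE z0.
have -> : ((x + 2) * (x + 2 - 1) / 4 * b) ^+ 2 * p * ((x + 4) * (x + 3)) * ((x + 2) * (x + 1)) =
  ((x + 2) * (x + 1)) ^+ 2 * (b ^+ 2 * p * ((x + 4) * ((x + 3) * ((x + 2) * (x + 1))))) / 16 by field.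
rewrite -NE (_ : b ^+ 2 * p * (N * 24) = 96); last by rewrite mulrA bE -natrM.
by field.
Qed.

(** The difference of the squares is rational of order 1/n, and [l >= 1] bounds the difference
    itself by that of the squares. *)
Lemma lam5_close m : [/\ 0 <= lam 4 m.+4.+2 m.+2, lam 4 m.+4.+2 m.+2 <= l &
  (l - lam 4 m.+4.+2 m.+2) * m.+4.+2%:R <= 24].
Proof.
have N0 : (0 < 'C(m.+4.+2 - 2, 4))%N by rewrite bin_gt0; lia.
have [b0 _] := beta_spec N0.
have la0 : 0 <= lam 4 m.+4.+2 m.+2.
  by rewrite /lam mulr_ge0 ?(ltW b0) // divr_ge0 // mulr_ge0 ?ler0n // subr_ge0 ler1n.
have E := lam5_sq m; have E' := sqr_limit_rate; have [l1 l2] := limit_rate_bounds.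
have -> : m.+4.+2%:R = m%:R + 6 :> R by rewrite -natrD (_ : (m + 6 = m.+4.+2)%N) //; lia.
have x0 : 0 <= m%:R :> R by rewrite ler0n.
have p2 := PI_ge2.
move: la0 E E' l1 l2 x0 p2; move: (lam _ _ _) (l) (m%:R) PI => a c x p a0 E E' l1 l2 x0 p2.
have D0 : 0 < (x + 4) * (x + 3) by rewrite mulr_gt0 //; lra.
have Ed : (c ^+ 2 - a ^+ 2) * p * ((x + 4) * (x + 3)) = 6 * (4 * x + 10).
  by rewrite !mulrBl E E'; ring.
have pD : 0 < p * ((x + 4) * (x + 3)) by rewrite mulr_gt0 //; lra.
have d0 : 0 <= c ^+ 2 - a ^+ 2.
  have Ed' : (c ^+ 2 - a ^+ 2) * (p * ((x + 4) * (x + 3))) = 6 * (4 * x + 10) by rewrite -Ed; ring.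
  by rewrite -(pmulr_lge0 _ pD) Ed' mulr_ge0 //; lra.
have ac : a <= c.
  by rewrite -(ler_pXn2r (n := 2)) ?nnegrE //; [rewrite -subr_ge0|lra].
split=> //.
have h1 : c - a <= c ^+ 2 - a ^+ 2.
  have -> : c ^+ 2 - a ^+ 2 = (c - a) * (c + a) by ring.
  by rewrite ler_peMr; lra.
apply: le_trans (ler_wpM2r (_ : 0 <= x + 6) h1) _; first lra.
rewrite -(ler_pM2r pD).
have -> : (c ^+ 2 - a ^+ 2) * (x + 6) * (p * ((x + 4) * (x + 3))) = 6 * (4 * x + 10) * (x + 6).
  by rewrite -Ed; ring.
have h2 : 2 * ((x + 4) * (x + 3)) <= p * ((x + 4) * (x + 3)) by rewrite ler_wpM2r // ltW.
by have := mulr_ge0 x0 x0; move: h2; move: (p * _) => q; lra.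
Qed.

Lemma lam5_close_n n : (6 <= n)%N -> [/\ 0 <= lam 4 n (n - 4), lam 4 n (n - 4) <= l &
  (l - lam 4 n (n - 4)) * n%:R <= 24].
Proof. by case: n => [|[|[|[|[|[|m]]]]]] // _; exact: (lam5_close m). Qed.

Lemma ler_dist_chain (eps p z u t c b s : R) :
    `|z - u| <= 2 * (eps / 10) -> `|u - t| <= s -> p <= z + c -> z <= p + b ->
    s <= eps / 5 -> b <= eps / 5 -> c <= eps / 5 ->
  `|p - t| <= eps.
Proof.
rewrite !ler_norml => /andP[z1 z2] /andP[e1 e2] up lo h1 h2 h3.
by apply/andP; split; lra.
Qed.

(** With [A] the complement of the 4-set [S0], Stein's equation yields exp(-lam) for no coincidence
    in [A]. Passing to strong 1-weighting costs pairs without a common edge from above and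
    coincidences meeting [S0] from below; lam is then replaced by its limit. *)
Lemma Pr_sw1_limit_5 :
  small (fun n => `|Pr R (fun H => sw1 (H :&: layer n 4)) - exp (- l)|).
Proof.
have k0 : (0 < 4)%N by [].
move=> eps e0; have e5 : 0 < eps / 5 by rewrite divr_gt0.
have e10 : 0 < eps / 10 by rewrite divr_gt0.
have sm : small (fun n => (n - 4)%:R * beta 4 n).
  apply: small_le (small_nbeta k0 (isT : 2 * 1 + 1 <= 4)%N).
  apply: ev_imp (ev_N k0 1) => n N0; have [b0 _] := beta_spec N0.
  by rewrite expr1 ler_wpM2r ?(ltW b0) // ler_nat leq_subr.
have [d [d0 d4 hd]] := small_rate k0 sm e10.
have sl : small (fun n => l - lam 4 n (n - 4)).
  apply: (@small_div 24); apply: ev_imp (ev_ge 6) => n n6.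
  by have [] := lam5_close_n n6.
have sn : small (fun n => 4 * n%:R * (6 * beta 4 n)).
  have h := smallZ (ler0n _ 24) (small_nbeta k0 (isT : 2 * 1 + 1 <= 4)%N).
  apply: small_le h; exists 0%N => n _; rewrite expr1 le_eqVlt; apply/orP; left; apply/eqP.
  by move: (beta 4 n) => b; ring.
apply: ev_imp (ev_and hd (ev_and (sl _ e5) (ev_and (sn _ e5) (ev_and (ev_N k0 8)
  (ev_and (ev_dN k0 d0) (ev_and (small_common (isT : 2 <= 4)%N e5) (ev_ge 6))))))).
move=> n [hr [hl [hn [N8 [dN [hc n6]]]]]].
have [b0 bE] : 0 < beta 4 n /\ _ := beta_spec (ltn_trans (isT : 0 < 7)%N N8).
have [la0 lal _] := lam5_close_n n6.
have n4 : (4 <= n)%N := leq_trans (isT : 4 <= 6)%N n6.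
have [|S0 _ S0k] := @exists_subset _ [set: 'I_n] 4%N; first by rewrite cardsT card_ord.
pose A := ~: S0.
have Am : #|A| = (n - 4)%N.
  have E : (#|S0| + #|A| = n)%N by rewrite cardsC card_ord.
  by move: (congr1 (fun j => j - 4)%N E); rewrite /= S0k addKn.
have AS0 : [disjoint A & S0] by rewrite disjoints_subset.
have NE : 'C(n - 2, 4) = 'C(#|'I_n| - 2, 4) by rewrite card_ord.
have rec m : #|pairs A|%:R * (beta 4 n / 2) * poisson_test (lam 4 n (n - 4)) m.+1
    - m%:R * poisson_test (lam 4 n (n - 4)) m = (m == 0%N)%:R - exp (- lam 4 n (n - 4)).
  by rewrite pairs_lam Am poisson_test_rec.
have := Pr_coincidences0_stein PI_ge2 PI_le4 wallis_lower wallis_upper N8 b0 bE S0k k0 AS0 NE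
  (fun m => poisson_test01 m la0) rec d0 d4 dN.
rewrite pairs_lam Am /rate Am => hZ.
have {}hZ : `|Pr R (fun H => coincidences 4 A H == 0%N) - exp (- lam 4 n (n - 4))| <= 2 * (eps / 10).
  apply: le_trans hZ _; apply: ler_pM (le_trans lal (proj2 limit_rate_bounds)) hr => //.
  apply: addr_ge0 (divr_ge0 (ltW b0) (exprn_ge0 2 (ltW d0))).
  apply: addr_ge0 (mulr_ge0 (ler0n R 4) (ltW d0)).
  exact: mulr_ge0 (mulr_ge0 (ler0n R 44) (ler0n R (n - 4))) (ltW b0).
have hE := exp_opp_dist la0 lal.
have hup := Pr_sw1_le R A k0.
have q0 : 0 <= 6 * beta 4 n by rewrite mulr_ge0 ?ler0n // ltW.
have n3 : (3 <= n)%N := leq_trans (isT : 3 <= 6)%N n6.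
have hlo := Pr_coincidences0_le q0 (fun x y xy => Pr_pair_le k0 N8 n3 xy) S0.
rewrite S0k -/A in hlo.
exact: ler_dist_chain hZ hE hup hlo hl hn hc.
Qed.

End Poisson.

(** * The limits for each uniformity *)

Local Notation Pr_nsw2 k n := (Pr R (fun H => ~~ strongly_weighted 2 (H :&: layer n k))).

Lemma almost_all_sw2_not_sw1 k : (2 <= k)%N -> small (fun n => Pr_sw1 k n) ->
  almost_all k.+1 sw2_not_sw1.
Proof.
move=> k2 s1; apply: (Un_cv_small _ (smallD s1 (small_nsw2 k2))).
exists 0%N => n _; rewrite subr0 probE (ger0_norm (Pr_ge0 _ _)).
apply: ler_PrU => H; rewrite /sw2_not_sw1 negb_and negbK orbC; exact.
Qed.

(** The first moment suffices: n^2 beta is of order n^(2 - k/2), which vanishes from k = 5 on. *)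
Lemma almost_all_sw1 k : (5 <= k)%N -> almost_all k.+1 sw1.
Proof.
move=> k5; have k0 : (0 < k)%N by lia.
have h := smallZ (ler0n _ 6) (small_nbeta k0 (k5 : 2 * 2 + 1 <= k)%N).
apply: (Un_cv_small _ h).
apply: ev_imp (ev_and (ev_N k0 8) (ev_ge 3)) => n [N8 n3].
rewrite subr0 probE (ger0_norm (Pr_ge0 _ _)).
have [b0 _] := beta_spec (ltn_trans (isT : 0 < 7)%N N8).
have q0 : 0 <= 6 * beta k n by rewrite mulr_ge0 ?ler0n // ltW.
apply: le_trans (Pr_nsw1_le q0 (fun x y xy => Pr_pair_le k0 N8 n3 xy)) _.
by rewrite mulrCA.
Qed.

Lemma Un_cv_prob_sw1_5 : Un_cv (prob 5 sw1) (exp (Ropp (sqrt (Rdiv 6 PI)))).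
Proof.
apply: (Un_cv_small _ Pr_sw1_limit_5).
by exists 0%N => n _; rewrite probE.
Qed.

(** The event lies in the complement of strong 1-weighting and fills it up to the rare failure of
    two weights. *)
Lemma Un_cv_prob_sw2_not_sw1_5 :
  Un_cv (prob 5 sw2_not_sw1) (Rminus 1 (exp (Ropp (sqrt (Rdiv 6 PI))))).
Proof.
apply: (Un_cv_small _ (smallD Pr_sw1_limit_5 (small_nsw2 (isT : 2 <= 4)%N))).
exists 0%N => n _; rewrite probE -[Rminus _ _]/(1 - exp (- sqrt (Rdiv 6 PI))).
have h1 : Pr R (fun H => sw2_not_sw1 (H :&: layer n 4)) <= 1 - Pr_sw1 4 n.
  rewrite -(PrC R (card_set_gt0 _)); apply: ler_Pr => H /andP[]; by [].
have h2 : 1 - Pr_sw1 4 n <= Pr R (fun H => sw2_not_sw1 (H :&: layer n 4)) + Pr_nsw2 4 n.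
  rewrite -(PrC R (card_set_gt0 _)); apply: ler_PrU => H /= ns.
  by rewrite /sw2_not_sw1 [X in _ && X]ns andbT orbN.
have q0 : 0 <= Pr_nsw2 4 n := Pr_ge0 _ _.
move: h1 h2 q0; move: (Pr R (fun H => sw2_not_sw1 _)) (Pr_sw1 4 n) (Pr_nsw2 4 n) (exp _) => x p q e h1 h2 q0.
have a1 := ler_norm (p - e); have a2 := ler_norm (e - p); rewrite distrC in a2.
by rewrite ler_norml; apply/andP; split; lra.
Qed.

Lemma natr6 : 6%:R = IZR (BinNums.Zpos (BinNums.xO (BinNums.xI BinNums.xH))) :> R.
Proof. by rewrite -INRE /=; Lra.lra. Qed.

Local Open Scope nat_scope.
Local Bind Scope R_scope with R.

Theorem theorem1p2 :
  (forall r : nat, (r = 3 \/ r = 4) -> almost_all r sw2_not_sw1)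
  /\ (Un_cv (prob 5 sw1) (exp (Ropp (sqrt (Rdiv 6 PI))))
      /\ Un_cv (prob 5 sw2_not_sw1) (Rminus 1 (exp (Ropp (sqrt (Rdiv 6 PI))))))
  /\ (forall r : nat, 6 <= r -> almost_all r sw1).
Proof.
split; last split.
- by move=> r [->|->]; apply: almost_all_sw2_not_sw1 => //; [exact: vanish_sw1_3|exact: vanish_sw1_4].
- by split; rewrite -natr6; [exact: Un_cv_prob_sw1_5|exact: Un_cv_prob_sw2_not_sw1_5].
- by case=> // k; exact: almost_all_sw1.
Qed.
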